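(* Let $F\in K[x]$ be a monic irreducible polynomial and suppose that $\mu$ is the only extension of $\nu_0$ to $L=K[x]/(F)$ (identified with the unique element $\mu$ of $\mathcal V_{F_\infty}$). Then for every $\nu\in\mathcal V\setminus\{\nu_0\}$ with $\nu<\mu$ we have $\mathrm{in}_\nu(F)=u\cdot\phi^r$ for some irreducible element $\phi$ of $\mathcal G_\nu$, some $u\in\mathcal U_\nu$ and some positive integer $r$.
   Context: $(K,\nu_0)$ is a valued field with value group $\Gamma_0$, and $\Gamma$ is a fixed totally ordered divisible abelian group containing $\Gamma_0$; $\Gamma_\infty=\Gamma\cup\{\infty\}$ with the usual conventions. A valuation on a commutative unital ring $R$ is a map $\nu:R\to\Gamma_\infty$ with $\nu(ab)=\nu(a)+\nu(b)$, $\nu(a+b)\geq\min\{\nu(a),\nu(b)\}$, $\nu(1)=0$, $\nu(0)=\infty$; nonzero elements may have value $\infty$. Its support is $\mathrm{supp}(\nu)=\{a\in R\mid\nu(a)=\infty\}$. $\mathcal V=\{\nu_0\}\cup\{\nu:K[x]\to\Gamma_\infty\mid \nu\text{ is a valuation extending }\nu_0\}$, partially ordered by: $\nu_0\leq\nu$ for all $\nu\in\mathcal V$, and for $\nu,\mu\in\mathcal V\setminus\{\nu_0\}$, $\nu\leq\mu$ iff $\nu(f)\leq\mu(f)$ for every $f\in K[x]$. For a monic irreducible $F\in K[x]$: $\mathcal V_{F_\infty}=\{\mu\in\mathcal V\mid\mathrm{supp}(\mu)=(F)\}$. A valuation $\mu\in\mathcal V_{F_\infty}$ is identified with the valuation it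 induces on the field $L=K[x]/(F)$; in this way $\mathcal V_{F_\infty}$ is the set of extensions of $\nu_0$ to $L$. For $\nu\in\mathcal V\setminus\{\nu_0\}$, the graded ring is $\mathcal G_\nu=\bigoplus_{\gamma\in\nu(K[x]),\,\gamma<\infty}\mathcal P_\gamma/\mathcal P_\gamma^+$, where $\mathcal P_\gamma=\{a\in K[x]\mid\nu(a)\geq\gamma\}$ and $\mathcal P_\gamma^+=\{a\in K[x]\mid\nu(a)>\gamma\}$, with multiplication induced by that of $K[x]$ (it is an integral domain). $\mathcal U_\nu$ is the set of units of $\mathcal G_\nu$. For $a\notin\mathrm{supp}(\nu)$, $\mathrm{in}_\nu(a)$ is the image of $a$ in $\mathcal P_{\nu(a)}/\mathcal P_{\nu(a)}^+\subseteq\mathcal G_\nu$; for $a\in\mathrm{supp}(\nu)$, $\mathrm{in}_\nu(a)=0$. *)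

(* Defs.v *)
From HB Require Import structures.
From mathcomp Require Import all_boot all_order all_algebra qfpoly.
From mathcomp Require Import boolp classical_sets cardinality fsbigop.

Set Implicit Arguments.
Unset Strict Implicit.
Unset Printing Implicit Defensive.

Import Order.TTheory GRing.Theory.

Local Open Scope ring_scope.

(* MathComp's porderZmodType does not relate the order to the addition, and HB
   rejects a structure joining the lattice hierarchy with Zmodule below
   realDomainType; totality is therefore a field, and the orderType structure
   is recovered by an instance. *)
HB.mixin Record isOrderedGroup G of Num.POrderedZmodule G := {
  oag_le_total : total (<=%R : rel G);
  oag_leD2l : forall z x y : G, x <= y -> z + x <= z + y
}.

#[short(type="oagType")]
HB.structure Definition OrderedAbGroup :=
  {G of Num.POrderedZmodule G & isOrderedGroup G}.

HB.instance Definition _ (G : oagType) :=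
  Order.POrder_isTotal.Build ring_display (OrderedAbGroup.sort G)
    (@oag_le_total G).

Definition divisible (G : zmodType) : Prop :=
  forall (n : nat) (x : G), (0 < n)%N -> exists y : G, y *+ n = x.

Section OrderedGroupTheory.
Variable G : oagType.
Implicit Types x y z t : G.

Lemma oag_leD2lE z x y : (z + x <= z + y) = (x <= y).
Proof.
apply/idP/idP; last exact: oag_leD2l.
by move=> /(oag_leD2l (- z)); rewrite !addKr.
Qed.

Lemma oag_ltD2lE z x y : (z + x < z + y) = (x < y).
Proof. by rewrite !lt_neqAle oag_leD2lE (inj_eq (addrI z)). Qed.

Lemma oag_leD x y z t : x <= y -> z <= t -> x + z <= y + t.
Proof.
move=> xy zt; apply: (@le_trans _ _ (x + t)); first by rewrite oag_leD2lE.
by rewrite ![_ + t]addrC oag_leD2lE.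
Qed.

Lemma oag_ltD x y z t : x < y -> z <= t -> x + z < y + t.
Proof.
move=> xy zt; apply: (@le_lt_trans _ _ (x + t)); first by rewrite oag_leD2lE.
by rewrite ![_ + t]addrC oag_ltD2lE.
Qed.

Lemma oag_double_eq0 x : x + x = 0 -> x = 0.
Proof.
move=> xx0; case: (ltgtP x 0) => // x0.
- by have := oag_ltD x0 (ltW x0); rewrite xx0 addr0 ltxx.
- by have := oag_ltD x0 (ltW x0); rewrite xx0 addr0 ltxx.
Qed.

End OrderedGroupTheory.

Inductive withinf (G : Type) : Type := Fin of G | Infty.
Arguments Infty {G}.

Section WithInf.
Variable G : oagType.
Implicit Types x y z : withinf G.

Definition option_of_withinf x : option G :=
  if x is Fin g then Some g else None.
Definition withinf_of_option (o : option G) : withinf G :=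
  if o is Some g then Fin g else Infty.
Lemma option_of_withinfK : cancel option_of_withinf withinf_of_option.
Proof. by case. Qed.

HB.instance Definition _ :=
  Choice.copy (withinf G) (can_type option_of_withinfK).

Definition winf_le x y : bool :=
  match x, y with
  | _, Infty => true
  | Infty, Fin _ => false
  | Fin g, Fin h => g <= h
  end.

Lemma winf_le_refl : reflexive winf_le. Proof. by case=> /=. Qed.
Lemma winf_le_anti : antisymmetric winf_le.
Proof. by move=> [g|] [h|] //= gh; rewrite (le_anti gh). Qed.
Lemma winf_le_trans : transitive winf_le.
Proof. by move=> [g|] [h|] [k|] //=; apply: le_trans. Qed.
Lemma winf_le_total : total winf_le.
Proof. by move=> [g|] [h|] //=; apply: le_total. Qed.

HB.instance Definition _ := Order.Le_isPOrder.Build ring_display (withinf G)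
  winf_le_refl winf_le_anti winf_le_trans.
HB.instance Definition _ := Order.POrder_isTotal.Build ring_display (withinf G)
  winf_le_total.

Definition winf_add x y : withinf G :=
  match x, y with
  | Fin g, Fin h => Fin (g + h)
  | _, _ => Infty
  end.

Lemma winf_addA : associative winf_add.
Proof. by move=> [g|] [h|] [k|] //=; rewrite addrA. Qed.
Lemma winf_addC : commutative winf_add.
Proof. by move=> [g|] [h|] //=; rewrite addrC. Qed.
Lemma winf_add0 : left_id (Fin 0) winf_add.
Proof. by move=> [g|] //=; rewrite add0r. Qed.

HB.instance Definition _ := GRing.isNmodule.Build (withinf G)
  winf_addA winf_addC winf_add0.

Lemma winf_lexx x : x <= Infty. Proof. by case: x. Qed.
Lemma winf_leE (g h : G) : (Fin g <= Fin h) = (g <= h). Proof. by []. Qed.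
Lemma Fin_inj : injective (@Fin G). Proof. by move=> g h []. Qed.
Lemma winf_ltE (g h : G) : (Fin g < Fin h) = (g < h).
Proof. by rewrite !lt_neqAle winf_leE (inj_eq Fin_inj). Qed.
Lemma winf_ltoo (g : G) : Fin g < Infty.
Proof. by rewrite lt_neqAle winf_lexx andbT; apply/eqP. Qed.

Lemma winf_leD (g h : G) x y : Fin g <= x -> Fin h <= y -> Fin (g + h) <= x + y.
Proof. by case: x y => [x|] [y|] //; rewrite !winf_leE; apply: oag_leD. Qed.

Lemma winf_ltD (g h : G) x y : Fin g < x -> Fin h <= y -> Fin (g + h) < x + y.
Proof.
case: x y => [x|] [y|]; rewrite ?winf_ltE ?winf_leE => *;
  by [apply: oag_ltD | apply: winf_ltoo].
Qed.

End WithInf.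

Record valuation (R : comNzRingType) (G : oagType) := Valuation {
  vfun :> R -> withinf G;
  vfunM : forall a b, vfun (a * b) = vfun a + vfun b;
  vfunD : forall a b, Order.min (vfun a) (vfun b) <= vfun (a + b);
  vfun1 : vfun 1 = Fin 0;
  vfun0 : vfun 0 = Infty
}.

Definition vsupp (R : comNzRingType) (G : oagType) (v : valuation R G)
  : {pred R} := fun a => v a == Infty.

Section ValuationTheory.
Variables (R : comNzRingType) (G : oagType).
Implicit Types v w : valuation R G.

Lemma valuation_ext v w : v =1 w -> v = w.
Proof.
case: v w => [v vM vD v1 v0] [w wM wD w1 w0] /= /funext vw; subst w.
by congr Valuation; apply: Prop_irrelevance.
Qed.

Lemma vfunN v a : v (- a) = v a.
Proof.
suff vN1 : v (-1) = 0 by rewrite -mulN1r vfunM vN1 add0r.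
have : v (-1) + v (-1) = Fin 0 by rewrite -vfunM mulN1r opprK vfun1.
by case: (v (-1)) => [g|//] [/oag_double_eq0 ->].
Qed.

Lemma vfun_leD v (x : withinf G) a b : x <= v a -> x <= v b -> x <= v (a + b).
Proof. by move=> xa xb; apply: le_trans (vfunD v a b); rewrite le_min xa. Qed.

Lemma vfun_ltD v (x : withinf G) a b : x < v a -> x < v b -> x < v (a + b).
Proof. by move=> xa xb; apply: lt_le_trans (vfunD v a b); rewrite lt_min xa. Qed.

HB.instance Definition _ := gen_eqMixin (valuation R G).
HB.instance Definition _ := gen_choiceMixin (valuation R G).

Definition val_le v w : bool := `[< forall a, v a <= w a >].

Lemma val_le_refl : reflexive val_le.
Proof. by move=> v; apply/asboolP. Qed.
Lemma val_le_anti : antisymmetric val_le.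
Proof.
move=> v w /andP[/asboolP vw /asboolP wv].
by apply: valuation_ext => a; apply: le_anti; rewrite vw wv.
Qed.
Lemma val_le_trans : transitive val_le.
Proof.
move=> w v u /asboolP vw /asboolP wu; apply/asboolP => a.
exact: le_trans (wu a).
Qed.

HB.instance Definition _ := Order.Le_isPOrder.Build ring_display (valuation R G)
  val_le_refl val_le_anti val_le_trans.

Lemma val_leP v w : reflect (forall a, v a <= w a) (v <= w).
Proof. exact: asboolP. Qed.

End ValuationTheory.

Definition extends (R S : comNzRingType) (G : oagType) (i : R -> S)
  (v : valuation R G) (w : valuation S G) : Prop := forall a, w (i a) = v a.

Section Pullback.
Variables (R S : comNzRingType) (G : oagType).
Variables (f : {rmorphism R -> S}) (w : valuation S G).

Lemma pullbackM a b : w (f (a * b)) = w (f a) + w (f b).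
Proof. by rewrite rmorphM vfunM. Qed.
Lemma pullbackD a b : Order.min (w (f a)) (w (f b)) <= w (f (a + b)).
Proof. by rewrite rmorphD vfunD. Qed.
Lemma pullback1 : w (f 1) = Fin 0. Proof. by rewrite rmorph1 vfun1. Qed.
Lemma pullback0 : w (f 0) = Infty. Proof. by rewrite rmorph0 vfun0. Qed.

Definition pullback : valuation R G :=
  @Valuation R G (fun a => w (f a)) pullbackM pullbackD pullback1 pullback0.

End Pullback.

Section QuotientField.
Variables (K : fieldType) (F : {poly K}) (hF : monic_irreducible_poly F).

Definition qfpoly_pi (p : {poly K}) : {poly %/ F with hF} := in_qpoly F p.

HB.instance Definition _ := GRing.isZmodMorphism.Build
  {poly K} {poly %/ F with hF} qfpoly_pi (raddfB (in_qpoly F)).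
HB.instance Definition _ := GRing.isMonoidMorphism.Build
  {poly K} {poly %/ F with hF} qfpoly_pi (in_qpoly_monoid_morphism F).

Lemma qfpoly_piC (c : K) : qfpoly_pi c%:P = qfpoly_const hF c.
Proof.
apply: val_inj; apply: in_qpoly_small; rewrite size_polyC.
by rewrite (leq_ltn_trans (leq_b1 _)) // size_mk_monic_gt1.
Qed.

Lemma qfpoly_pi_eq0 (p : {poly K}) : (qfpoly_pi p == 0) = (F %| p).
Proof.
rewrite -val_eqE /= (mk_monicE hF) dvdpE.
by rewrite /Pdiv.Ring.rdvdp.
Qed.

Lemma qfpoly_pi_surj (x : {poly %/ F with hF}) : qfpoly_pi (val x) = x.
Proof. by apply: val_inj; apply: in_qpoly_small; apply: size_mk_monic. Qed.

End QuotientField.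

Section ExtensionsToL.
Variables (K : fieldType) (G : oagType) (nu0 : valuation K G).
Variables (F : {poly K}) (hF : monic_irreducible_poly F).

Definition VFinf (mu : valuation {poly K} G) : Prop :=
  extends polyC nu0 mu /\ (forall a, (a \in vsupp mu) = (F %| a)).

(* This lemma and VFinf_pullback identify the extensions of nu0 to K[x]/(F) with
   the valuations on K[x] extending nu0 whose support is (F). *)
Lemma pullback_VFinf (eta : valuation {poly %/ F with hF} G) :
  extends (qfpoly_const hF) nu0 eta -> VFinf (pullback (qfpoly_pi hF) eta).
Proof.
move=> ext; split=> [c|a]; first by rewrite /= qfpoly_piC.
rewrite -(qfpoly_pi_eq0 hF) unfold_in /=; set b := qfpoly_pi hF a.
have [->|b0] := eqVneq b 0; first by rewrite vfun0 eqxx.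
apply/eqP => vb; have := vfun1 eta.
by rewrite -(mulVf b0) vfunM vb; case: (eta _).
Qed.

Lemma VFinf_pullback (mu : valuation {poly K} G) : VFinf mu ->
  exists2 eta : valuation {poly %/ F with hF} G,
    extends (qfpoly_const hF) nu0 eta & mu = pullback (qfpoly_pi hF) eta.
Proof.
move=> [ext supp].
have le p q : F %| p - q -> mu p <= mu q.
  rewrite -supp => /eqP spq.
  have -> : q = p + (q - p) by rewrite addrC subrK.
  by apply: vfun_leD => //; rewrite -opprB vfunN spq winf_lexx.
pose e (x : {poly %/ F with hF}) := mu (val x).
have eE p : e (qfpoly_pi hF p) = mu p.
  have dv : F %| p - val (qfpoly_pi hF p).
    by rewrite -(qfpoly_pi_eq0 hF) rmorphB subr_eq0 eq_sym; apply/eqP/qfpoly_pi_surj.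
  by apply/le_anti; rewrite !le // -opprB dvdpNr.
have eM x y : e (x * y) = e x + e y.
  by rewrite -(qfpoly_pi_surj x) -(qfpoly_pi_surj y) -rmorphM !eE vfunM.
have eD x y : Order.min (e x) (e y) <= e (x + y).
  by rewrite -(qfpoly_pi_surj x) -(qfpoly_pi_surj y) -rmorphD !eE vfunD.
have e1 : e 1 = Fin 0 by rewrite -(rmorph1 (qfpoly_pi hF)) eE vfun1.
have e0 : e 0 = Infty by rewrite -(rmorph0 (qfpoly_pi hF)) eE vfun0.
exists (Valuation eM eD e1 e0); first by move=> c; rewrite -qfpoly_piC /= eE.
by apply: valuation_ext => p; rewrite /= eE.
Qed.

End ExtensionsToL.

Section Pieces.
Variables (R : comNzRingType) (G : oagType) (v : valuation R G) (g : G).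

Definition Pge_pred : {pred R} := fun a => Fin g <= v a.

Lemma Pge_zmod_closed : zmod_closed Pge_pred.
Proof.
split=> [|a b]; rewrite !unfold_in ?vfun0 ?winf_lexx // => va vb.
by apply: vfun_leD; rewrite ?vfunN.
Qed.
HB.instance Definition _ := GRing.isZmodClosed.Build R Pge_pred Pge_zmod_closed.

Record Pge := MkPge { Pge_val :> R; _ : Pge_val \in Pge_pred }.
HB.instance Definition _ := [isSub for Pge_val].
HB.instance Definition _ := [Choice of Pge by <:].
HB.instance Definition _ := [SubChoice_isSubZmodule of Pge by <:].

Definition Pgt : {pred Pge} := fun a => Fin g < v (val a).

Lemma Pgt_zmod_closed : zmod_closed Pgt.
Proof.
split=> [|a b]; rewrite !unfold_in /Pgt ?raddf0 ?vfun0 ?winf_ltoo // => va vb.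
by rewrite raddfB; apply: vfun_ltD; rewrite ?vfunN.
Qed.
HB.instance Definition _ := GRing.isZmodClosed.Build Pge Pgt Pgt_zmod_closed.

Definition piece : zmodType := Quotient.quot Pgt.

(* The class of a in P_g / P_g^+ when v a >= g; otherwise a junk value, the
   class of 0. *)
Definition cls (a : R) : piece := \pi_(Quotient.quot Pgt)%qT (insubd (0 : Pge) a).

Definition rep (x : piece) : R := val (repr (x : Quotient.quot Pgt)).

Lemma repP x : Fin g <= v (rep x).
Proof. exact: (valP (repr (x : Quotient.quot Pgt) : Pge)). Qed.

Lemma cls_rep x : cls (rep x) = x.
Proof. by rewrite /cls /rep valKd reprK. Qed.

Lemma eq_cls a b : Fin g <= v a -> Fin g <= v b ->
  (cls a = cls b) <-> (Fin g < v (a - b)).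
Proof.
move=> va vb; rewrite /cls.
have -> : (Fin g < v (a - b)) = (insubd (0 : Pge) a - insubd 0 b \in Pgt).
  by rewrite unfold_in /Pgt raddfB /= !insubdK.
by rewrite Quotient.idealrBE; split=> [->|/eqP].
Qed.

Lemma clsD a b : Fin g <= v a -> Fin g <= v b -> cls (a + b) = cls a + cls b.
Proof.
move=> va vb; rewrite /cls -raddfD; congr (\pi_(_)%qT _); apply: val_inj.
by rewrite raddfD /= !insubdK // unfold_in; apply: vfun_leD.
Qed.

Lemma cls0 : cls 0 = 0.
Proof.
rewrite /cls -[RHS](raddf0 (\pi_(Quotient.quot Pgt)%qT)).
congr (\pi_(_)%qT _); apply: val_inj.
by rewrite insubdK // rpred0.
Qed.

Lemma cls_eq0 a : Fin g <= v a -> (cls a = 0) <-> (Fin g < v a).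
Proof. by move=> va; rewrite -cls0 eq_cls ?subr0 // vfun0 winf_lexx. Qed.

Lemma rep0 : Fin g < v (rep 0).
Proof. by apply/cls_eq0; rewrite ?cls_rep //; apply: repP. Qed.

End Pieces.

(* The summand indexed by g is zero unless g is a value of v, so that summing
   over all of G is the same as summing over the finite values of v. *)
Record gr (R : comNzRingType) (G : oagType) (v : valuation R G) := MkGr {
  gcoef :> forall g : G, piece v g;
  gr_finite : finite_set [set g | gcoef g != 0]%classic
}.

Section GradedRing.
Variables (R : comNzRingType) (G : oagType) (v : valuation R G).
Implicit Types x y z : gr v.

Lemma gr_ext x y : (forall g, x g = y g) -> x = y.
Proof.
case: x y => [x xf] [y yf] /= xy.
have {}xy : x = y by apply: functional_extensionality_dep.
subst y.
by congr MkGr; apply: Prop_irrelevance.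
Qed.

HB.instance Definition _ := gen_eqMixin (gr v).
HB.instance Definition _ := gen_choiceMixin (gr v).

Lemma gr_supp_ex x :
  exists s : seq G, uniq s /\ forall g, g \notin s -> x g = 0.
Proof.
have /finite_seqP[s sE] := gr_finite x.
exists (undup s); split=> [|g]; first exact: undup_uniq.
rewrite mem_undup => /negP gs; apply/eqP; apply: contra_notT gs => xg.
by have : [set g | x g != 0]%classic g by []; rewrite sE.
Qed.

Lemma finite_supp_seq (x : forall g, piece v g) (s : seq G) :
  (forall g, g \notin s -> x g = 0) -> finite_set [set g | x g != 0]%classic.
Proof.
move=> xs; apply: (@sub_finite_set _ _ [set` s]%classic) => [g /=|].
  by apply: contraNT => /xs ->.
by apply/finite_seqP; exists s.
Qed.

Lemma gr_zero_finite : finite_set [set g : G | (0 : piece v g) != 0]%classic.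
Proof. exact: (@finite_supp_seq (fun=> 0) [::]). Qed.

Lemma gr_opp_finite x : finite_set [set g | - x g != 0]%classic.
Proof.
have [s [_ xs]] := gr_supp_ex x.
by apply: (@finite_supp_seq (fun g => - x g) s) => g /xs ->; rewrite oppr0.
Qed.

Lemma gr_add_finite x y : finite_set [set g | x g + y g != 0]%classic.
Proof.
have [s [_ xs]] := gr_supp_ex x; have [t [_ yt]] := gr_supp_ex y.
apply: (@finite_supp_seq (fun g => x g + y g) (s ++ t)) => g.
by rewrite mem_cat negb_or => /andP[/xs -> /yt ->]; rewrite addr0.
Qed.

Definition gr_zero : gr v := MkGr gr_zero_finite.
Definition gr_opp x : gr v := MkGr (gr_opp_finite x).
Definition gr_add x y : gr v := MkGr (gr_add_finite x y).

Lemma gr_addA : associative gr_add.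
Proof. by move=> x y z; apply: gr_ext => g /=; rewrite addrA. Qed.
Lemma gr_addC : commutative gr_add.
Proof. by move=> x y; apply: gr_ext => g /=; rewrite addrC. Qed.
Lemma gr_add0 : left_id gr_zero gr_add.
Proof. by move=> x; apply: gr_ext => g /=; rewrite add0r. Qed.
Lemma gr_addN : left_inverse gr_zero gr_opp gr_add.
Proof. by move=> x; apply: gr_ext => g /=; rewrite addNr. Qed.

HB.instance Definition _ :=
  GRing.isZmodule.Build (gr v) gr_addA gr_addC gr_add0 gr_addN.

(* The product P_h / P_h^+ x P_(g - h) / P_(g - h)^+ -> P_g / P_g^+. *)
Definition piece_mul (g h : G) (a : piece v h) (b : piece v (g - h)) :
  piece v g := cls v g (rep a * rep b).

Lemma PgeM (g h : G) a b :
  Fin h <= v a -> Fin (g - h) <= v b -> Fin g <= v (a * b).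
Proof.
by move=> va vb; rewrite vfunM -[g](subrKC h); apply: winf_leD.
Qed.

Lemma PgtM (g h : G) a b :
  Fin h < v a -> Fin (g - h) <= v b -> Fin g < v (a * b).
Proof.
by move=> va vb; rewrite vfunM -[g](subrKC h); apply: winf_ltD.
Qed.

Lemma piece_mulE (g h : G) a b : Fin h <= v a -> Fin (g - h) <= v b ->
  piece_mul (cls v h a) (cls v (g - h) b) = cls v g (a * b).
Proof.
move=> va vb; apply/eq_cls; try exact: PgeM (repP _) (repP _).
  exact: PgeM va vb.
set a' := rep _; set b' := rep _.
have aa' : Fin h < v (a' - a) by apply/eq_cls; rewrite ?cls_rep // repP.
have bb' : Fin (g - h) < v (b' - b) by apply/eq_cls; rewrite ?cls_rep // repP.
have -> : a' * b' - a * b = (a' - a) * b' + (b' - b) * a.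
  by rewrite !mulrBl addrA [a * b']mulrC subrK [b * a]mulrC.
apply: vfun_ltD; first exact: PgtM (repP _).
by apply: (@PgtM _ (g - h)); rewrite // subKr.
Qed.

Lemma piece_mul0l (g h : G) (b : piece v (g - h)) :
  piece_mul (0 : piece v h) b = 0.
Proof.
apply/cls_eq0; first exact: (@PgeM _ h) (repP _) (repP _).
exact: (@PgtM _ h) (rep0 _ _) (repP _).
Qed.

Lemma piece_mulDl (g h : G) (a a' : piece v h) b :
  piece_mul (a + a') b = piece_mul a b + piece_mul a' b :> piece v g.
Proof.
rewrite -[a]cls_rep -[a']cls_rep -[b]cls_rep -clsD ?repP //.
have aD : Fin h <= v (rep a + rep a') by apply: vfun_leD; apply: repP.
rewrite !piece_mulE ?repP // mulrDl clsD //; exact: PgeM (repP _) (repP _).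
Qed.

Lemma piece_mulDr (g h : G) (a : piece v h) b b' :
  piece_mul a (b + b') = piece_mul a b + piece_mul a b' :> piece v g.
Proof.
rewrite -[a]cls_rep -[b']cls_rep -[b]cls_rep -clsD ?repP //.
have bD : Fin (g - h) <= v (rep b + rep b') by apply: vfun_leD; apply: repP.
rewrite !piece_mulE ?repP // mulrDr clsD //; exact: PgeM (repP _) (repP _).
Qed.

Lemma piece_mul0r (g h : G) (a : piece v h) : piece_mul a 0 = 0 :> piece v g.
Proof. by apply: (addrI (piece_mul a 0)); rewrite -piece_mulDr !addr0. Qed.

Lemma piece_mul_sumr (g h : G) (a : piece v h) (s : seq G) f :
  piece_mul a (\sum_(i <- s) f i) = \sum_(i <- s) piece_mul a (f i) :> piece v g.
Proof.
by apply: (big_morph (piece_mul a)); [apply: piece_mulDr | apply: piece_mul0r].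
Qed.

Definition gr_mul_coef x y (g : G) : piece v g :=
  \sum_(h \in [set: G]%classic) piece_mul (x h) (y (g - h)).

Lemma gr_mul_coefE x y (s : seq G) g : uniq s ->
    (forall h, h \notin s -> x h = 0) ->
  gr_mul_coef x y g = \sum_(h <- s) piece_mul (x h) (y (g - h)).
Proof.
move=> us xs; rewrite [RHS]fsbig_seq //.
rewrite /gr_mul_coef [RHS](fsbig_widen _ [set: G]%classic) //.
by move=> h /= [_ /negP/xs ->]; rewrite piece_mul0l.
Qed.

Lemma gr_mul_finite x y : finite_set [set g | gr_mul_coef x y g != 0]%classic.
Proof.
have [s [us xs]] := gr_supp_ex x; have [t [_ yt]] := gr_supp_ex y.
apply: (@finite_supp_seq _ [seq h + k | h <- s, k <- t]) => g gst.
rewrite (gr_mul_coefE _ _ us xs) big1_seq // => h /= hs.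
rewrite (yt (g - h)) ?piece_mul0r //; apply: contra gst => ght.
by apply/allpairsP; exists (h, g - h); rewrite /= subrKC.
Qed.

Definition gr_mul x y : gr v := MkGr (gr_mul_finite x y).

Lemma gr_mulC : commutative gr_mul.
Proof.
move=> x y; apply: gr_ext => g /=; rewrite /gr_mul_coef.
rewrite (reindex_fsbigT (fun h => g - h)); last first.
  by exists (fun h => g - h) => h; rewrite subKr.
by apply: eq_fsbigr => h _; rewrite /piece_mul subKr mulrC.
Qed.

Lemma gr_mulDl : left_distributive gr_mul gr_add.
Proof.
move=> x y z; apply: gr_ext => g /=.
have [s [_ xs]] := gr_supp_ex x; have [t [_ yt]] := gr_supp_ex y.
have ust := undup_uniq (s ++ t).
have xs' h : h \notin undup (s ++ t) -> x h = 0.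
  by rewrite mem_undup mem_cat negb_or => /andP[/xs].
have yt' h : h \notin undup (s ++ t) -> y h = 0.
  by rewrite mem_undup mem_cat negb_or => /andP[_ /yt].
rewrite !(@gr_mul_coefE _ _ (undup (s ++ t))) // -?big_split.
  by apply: eq_bigr => h _ /=; rewrite piece_mulDl.
by move=> h hst /=; rewrite xs' // yt' // addr0.
Qed.

Lemma gr_mulCA : left_commutative gr_mul.
Proof.
move=> x z y; apply: gr_ext => g /=.
have [s [us xs]] := gr_supp_ex x; have [t [ut zt]] := gr_supp_ex z.
rewrite (gr_mul_coefE _ _ us xs) (gr_mul_coefE _ _ ut zt) /=.
under eq_bigr do rewrite (gr_mul_coefE _ _ ut zt) piece_mul_sumr.
under [RHS]eq_bigr do rewrite (gr_mul_coefE _ _ us xs) piece_mul_sumr.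
rewrite exchange_big /=; apply: eq_bigr => k _; apply: eq_bigr => h _.
have E (h' k' : G) (a : piece v h') (b : piece v k') (c : piece v (g - h' - k')) :
  piece_mul a (piece_mul b c) = cls v g (rep a * (rep b * rep c)).
  rewrite -{1}[a]cls_rep {1}/piece_mul -/(piece_mul _ _).
  rewrite [X in piece_mul _ X]/piece_mul piece_mulE ?repP //.
  exact: PgeM (repP _) (repP _).
by rewrite !E mulrCA addrAC.
Qed.

Lemma gr_mulA : associative gr_mul.
Proof. by move=> x y z; rewrite [gr_mul y z]gr_mulC gr_mulCA gr_mulC. Qed.

(* in_v(a): the class of a in degree v a and 0 elsewhere. No degree satisfies
   the test when v a is infinite, so in_v(a) = 0 for a in the support. *)
Definition init_coef (a : R) (g : G) : piece v g :=
  if v a == Fin g then cls v g a else 0.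

Lemma init_finite a : finite_set [set g | init_coef a g != 0]%classic.
Proof.
apply: (@finite_supp_seq _ (if v a is Fin g then [:: g] else [::])) => g.
rewrite /init_coef; case: eqP => // ->.
by rewrite inE eqxx.
Qed.

Definition init (a : R) : gr v := MkGr (init_finite a).

Lemma init_supp a : a \in vsupp v -> init a = 0.
Proof.
move=> /eqP va; apply: gr_ext => g /=.
by rewrite /init_coef va.
Qed.

Lemma gr_mul1 : left_id (init 1) gr_mul.
Proof.
move=> x; apply: gr_ext => g /=.
have i0 h : h \notin [:: 0] -> init 1 h = 0.
  by rewrite inE /= /init_coef vfun1 => /eqP h0; case: eqP => // -[/esym].
rewrite (@gr_mul_coefE _ _ [:: 0]) // big_seq1 /= /init_coef vfun1 eqxx.
rewrite -[x (g - 0)]cls_rep piece_mulE ?repP ?vfun1 // mul1r subr0.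
by rewrite cls_rep.
Qed.

Lemma gr_1_neq0 : init 1 != 0.
Proof.
apply/eqP => /(congr1 (fun x : gr v => x 0)) /=.
by rewrite /init_coef vfun1 eqxx => /cls_eq0; rewrite vfun1 ltxx => /(_ (lexx _)).
Qed.

HB.instance Definition _ := GRing.Zmodule_isComNzRing.Build (gr v)
  gr_mulA gr_mulC gr_mul1 gr_mulDl gr_1_neq0.

Definition gr_unit : pred (gr v) := fun x => `[< exists y, y * x = 1 >].

Definition gr_inv x : gr v :=
  if pselect (exists y, y * x = 1) is left ex then projT1 (cid ex) else x.

Lemma gr_mulVx : {in gr_unit, left_inverse 1 gr_inv *%R}.
Proof.
move=> x /asboolP ux; rewrite /gr_inv; case: pselect => // ex.
exact: projT2 (cid ex).
Qed.
Lemma gr_unitP x y : y * x = 1 -> gr_unit x.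
Proof. by move=> yx; apply/asboolP; exists y. Qed.
Lemma gr_inv_out : {in [predC gr_unit], gr_inv =1 id}.
Proof.
by move=> x /asboolP ux; rewrite /gr_inv; case: pselect.
Qed.

HB.instance Definition _ := GRing.ComNzRing_hasMulInverse.Build (gr v)
  gr_mulVx gr_unitP gr_inv_out.

End GradedRing.

Definition irreducible_elt (R : comUnitRingType) (x : R) : Prop :=
  [/\ x != 0, x \isn't a GRing.unit &
      forall a b : R, x = a * b -> a \is a GRing.unit \/ b \is a GRing.unit].

(* Main.v *)
Require Import Defs.
From mathcomp Require Import all_boot all_order all_algebra qfpoly.
From mathcomp Require Import boolp classical_sets.

Set Implicit Arguments.
Unset Strict Implicit.
Unset Printing Implicit Defensive.

Import Order.TTheory GRing.Theory.

Local Open Scope ring_scope.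

(** Write [mu] also for the pullback of [mu] to K[x]; it takes the value
    infinity exactly on (F).  By uniqueness [nu F] is finite: otherwise [nu]
    would have support (F), hence induce an extension of [nu0] to L, hence be
    [mu].  It follows that [nu] has trivial support and that
    [nu F < mu F].

    Say that f jumps when [nu f < mu f].  Jumping depends only on the initial
    form of f, and a product jumps iff a factor does.  Take [phi] of least
    degree among the polynomials that jump.  Euclidean division shows that a
    jumping f has the same initial form as [f %/ phi * phi] ([jump_divp]): the
    remainder does not jump, and so is negligible.  Hence in(phi) divides the
    initial form of everything that jumps; as factors of a homogeneous element
    are themselves initial forms ([init_mul_homogeneous]), in(phi) is
    irreducible ([init_phi_irreducible]).  Dividing F repeatedly gives
    in(F) = in(q) in(phi)^r, where q does not jump ([jump_factor]); r is
    positive because F jumps.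

    It remains to see that in(q) is a unit ([nonjump_unit]), which is where
    uniqueness of [mu] enters a second time.  A suitable [y = q^n / c] with c in
    K has [mu y = 0].  If the ideal generated by y in O[y], with O the valuation
    ring of [nu0], were proper, then together with the maximal ideal of O it
    would still generate a proper ideal, and Chevalley's theorem would yield an
    extension of [nu0] to L that is positive at y ([exists_extension_gt0]),
    contradicting uniqueness.  So y p(y) = 1 in L for some p over O: in K[x],
    y p(y) - 1 is a multiple of F.  In the graded ring, in(y) p(in y) - 1 is then
    a multiple of in(F), and in(q) divides both in(y) and in(F); so it divides 1.
    The identity is used on polynomials, through the relation [vsim] of having
    the same initial form, and not inside the graded ring. *)

(** * Chevalley's theorem: enlarging a proper ideal to a valuation ring *)

Section IdealPairs.
Variable L : fieldType.
Implicit Types (A M S : set L) (a b z : L) (p q : {poly L}).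

(** Chevalley's argument is run on pairs of a subring and a proper ideal of it,
    not on subrings alone: the ideal records which elements the valuation to be
    built must make positive. *)
Record ideal_pair A M : Prop := IdealPair {
  ip_one : A 1;
  ip_subB : forall a b, A a -> A b -> A (a - b);
  ip_subM : forall a b, A a -> A b -> A (a * b);
  ip_sub : forall a, M a -> A a;
  ip_idB : forall a b, M a -> M b -> M (a - b);
  ip_idM : forall a b, A a -> M b -> M (a * b);
  ip_id0 : M 0;
  ip_id1 : ~ M 1 }.

Section Theory.
Variables (A M : set L) (AM : ideal_pair A M).

Lemma ip_sub0 : A 0.
Proof. exact: (ip_sub AM (ip_id0 AM)). Qed.

Lemma ip_subN a : A a -> A (- a).
Proof. by move=> Aa; rewrite -sub0r; apply: (ip_subB AM) => //; exact: ip_sub0. Qed.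

Lemma ip_idN a : M a -> M (- a).
Proof. by move=> Ma; rewrite -sub0r; apply: (ip_idB AM) => //; exact: (ip_id0 AM). Qed.

Lemma ip_subD a b : A a -> A b -> A (a + b).
Proof.
by move=> Aa Ab; rewrite -[b]opprK; apply: (ip_subB AM) => //; exact: ip_subN.
Qed.

Lemma ip_idD a b : M a -> M b -> M (a + b).
Proof. by move=> Aa Ab; rewrite -[b]opprK; apply: (ip_idB AM) => //; exact: ip_idN. Qed.

Lemma ip_subX a n : A a -> A (a ^+ n).
Proof.
move=> Aa; elim: n => [|n IH]; rewrite ?expr0 ?exprS; first exact: (ip_one AM).
exact: (ip_subM AM).
Qed.

Lemma ip_idX a n : M a -> (0 < n)%N -> M (a ^+ n).
Proof.
case: n => // n Ma _; rewrite exprSr; apply: (ip_idM AM) => //.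
exact/ip_subX/(ip_sub AM).
Qed.

Lemma ip_sub_sum I (r : seq I) (P : pred I) (f : I -> L) :
  (forall i, P i -> A (f i)) -> A (\sum_(i <- r | P i) f i).
Proof. by move=> Af; apply: big_ind => //; [apply: ip_sub0 | apply: ip_subD]. Qed.

Lemma ip_id_sum I (r : seq I) (P : pred I) (f : I -> L) :
  (forall i, P i -> M (f i)) -> M (\sum_(i <- r | P i) f i).
Proof.
by move=> Mf; apply: big_ind => //; [apply: (ip_id0 AM) | apply: ip_idD].
Qed.

Lemma ip_unit_notin a b : A a -> M b -> a * b <> 1.
Proof. by move=> Aa Mb ab1; apply: (ip_id1 AM); rewrite -ab1; apply: (ip_idM AM). Qed.

End Theory.

Definition adjoin S z : set L :=
  [set a | exists2 p : {poly L}, (forall i, S p`_i) & a = p.[z]]%classic.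

Lemma sub_adjoin S z a : S 0 -> S a -> adjoin S z a.
Proof.
move=> S0 Sa; exists a%:P; last by rewrite hornerC.
by move=> i; rewrite coefC; case: ifP.
Qed.

Lemma adjoin_gen A M z : ideal_pair A M -> adjoin A z z.
Proof.
move=> AM; exists 'X; last by rewrite hornerX.
by move=> i; rewrite coefX; case: eqP => _; [apply: (ip_one AM) | apply: (ip_sub0 AM)].
Qed.

Lemma adjoin_ideal_pair A M z :
  ideal_pair A M -> ~ adjoin M z 1 -> ideal_pair (adjoin A z) (adjoin M z).
Proof.
move=> AM Mz1; split => //.
- by apply: sub_adjoin; [apply: (ip_sub0 AM) | apply: (ip_one AM)].
- move=> _ _ [p Ap ->] [q Aq ->]; exists (p - q); last by rewrite hornerD hornerN.
  by move=> i; rewrite coefB; apply: (ip_subB AM).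
- move=> _ _ [p Ap ->] [q Aq ->]; exists (p * q); last by rewrite hornerM.
  move=> i; rewrite coefM; apply: (ip_sub_sum AM) => j _.
  by apply: (ip_subM AM).
- by move=> _ [p Mp ->]; exists p => // i; apply: (ip_sub AM).
- move=> _ _ [p Ap ->] [q Aq ->]; exists (p - q); last by rewrite hornerD hornerN.
  by move=> i; rewrite coefB; apply: (ip_idB AM).
- move=> _ _ [p Ap ->] [q Aq ->]; exists (p * q); last by rewrite hornerM.
  move=> i; rewrite coefM; apply: (ip_id_sum AM) => j _.
  by apply: (ip_idM AM).
- by apply: sub_adjoin; apply: (ip_id0 AM).
Qed.

(** Zorn's lemma: the union of a chain of pairs is again a pair, because [1]
    belongs to no ideal of the chain. *)
Lemma maximal_ideal_pair A0 M0 : ideal_pair A0 M0 ->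
  exists A M, [/\ ideal_pair A M, (A0 `<=` A)%classic, (M0 `<=` M)%classic &
    forall B N, ideal_pair B N -> (A `<=` B)%classic -> (M `<=` N)%classic ->
      (B `<=` A)%classic /\ (N `<=` M)%classic].
Proof.
move=> AM0; pose T := {AM : set L * set L | [/\ ideal_pair AM.1 AM.2,
  (A0 `<=` AM.1)%classic & (M0 `<=` AM.2)%classic]}.
pose R (s t : T) := `[< ((sval s).1 `<=` (sval t).1)%classic
                     /\ ((sval s).2 `<=` (sval t).2)%classic >].
have t0P : [/\ ideal_pair (A0, M0).1 (A0, M0).2, (A0 `<=` (A0, M0).1)%classic
             & (M0 `<=` (A0, M0).2)%classic] by split.
pose t0 : T := exist _ (A0, M0) t0P.
have [||C Ctot|[[A M] /= [AM sA sM]] tmax] := @ZL_preorder T t0 R.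
- by move=> t; apply/asboolP; split.
- move=> r s t /asboolP[rs rs'] /asboolP[st st']; apply/asboolP; split.
    exact: subset_trans rs st.
  exact: subset_trans rs' st'.
- have [C0|/forallNP C0] := pselect (exists s, C s); last first.
    by exists t0 => s /C0.
  have [s0 Cs0] := C0; have [s0P s0A s0M] := svalP s0.
  pose UA : set L := [set a | exists2 s, C s & (sval s).1 a]%classic.
  pose UM : set L := [set a | exists2 s, C s & (sval s).2 a]%classic.
  have join s t : C s -> C t -> exists u : T, [/\ C u,
      ((sval s).1 `<=` (sval u).1)%classic, ((sval t).1 `<=` (sval u).1)%classic,
      ((sval s).2 `<=` (sval u).2)%classic & ((sval t).2 `<=` (sval u).2)%classic].
    move=> Cs Ct; case: (Ctot s t Cs Ct) => /asboolP[st st'].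
      by exists t; split.
    by exists s; split.
  have UP : ideal_pair UA UM.
    split.
    - by exists s0 => //; apply: (ip_one s0P).
    - move=> a b [s Cs sa] [t Ct tb]; have [u [Cu su tu _ _]] := join s t Cs Ct.
      have [uP _ _] := svalP u.
      by exists u => //; apply: (ip_subB uP); [apply: su | apply: tu].
    - move=> a b [s Cs sa] [t Ct tb]; have [u [Cu su tu _ _]] := join s t Cs Ct.
      have [uP _ _] := svalP u.
      by exists u => //; apply: (ip_subM uP); [apply: su | apply: tu].
    - move=> a [s Cs sa]; exists s => //; have [sP _ _] := svalP s.
      by apply: (ip_sub sP).
    - move=> a b [s Cs sa] [t Ct tb]; have [u [Cu _ _ su tu]] := join s t Cs Ct.
      have [uP _ _] := svalP u.
      by exists u => //; apply: (ip_idB uP); [apply: su | apply: tu].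
    - move=> a b [s Cs sa] [t Ct tb]; have [u [Cu su _ _ tu]] := join s t Cs Ct.
      have [uP _ _] := svalP u.
      by exists u => //; apply: (ip_idM uP); [apply: su | apply: tu].
    - by exists s0 => //; apply: (ip_id0 s0P).
    - by case=> s _; have [sP _ _] := svalP s; apply: (ip_id1 sP).
  have UT : [/\ ideal_pair (UA, UM).1 (UA, UM).2, (A0 `<=` (UA, UM).1)%classic
             & (M0 `<=` (UA, UM).2)%classic].
    by split=> // a aP; exists s0 => //; [apply: s0A | apply: s0M].
  exists (exist _ (UA, UM) UT) => s Cs; apply/asboolP.
  by split=> a sa; exists s.
- exists A, M; split=> // B N BN AB MN.
  have tP : [/\ ideal_pair (B, N).1 (B, N).2, (A0 `<=` (B, N).1)%classic
             & (M0 `<=` (B, N).2)%classic].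
    by split=> // a aP; [apply/AB/sA | apply/MN/sM].
  by have /asboolP[] := tmax (exist _ (B, N) tP) (asboolT (conj AB MN)).
Qed.

(** A valuation ring of L together with its maximal ideal: the second field says
    at once that every element or its inverse is in [A], and that elements whose
    inverse is outside [A] are in [M]. *)
Record valuation_pair A M : Prop := ValuationPair {
  vp_proper : ideal_pair A M;
  vp_total : forall z, ~ A z -> M z^-1 }.

Section MaximalPair.
Variables (A M : set L) (AM : ideal_pair A M).
Hypothesis AMmax : forall B N, ideal_pair B N -> (A `<=` B)%classic ->
  (M `<=` N)%classic -> (B `<=` A)%classic /\ (N `<=` M)%classic.

(** Adjoining [z] to [A] would enlarge the pair, so the extended ideal cannot be
    proper. *)
Lemma maximal_adjoin1 z : ~ A z -> adjoin M z 1.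
Proof.
move=> nAz; apply: contrapT => Mz1; apply: nAz.
have A0 := ip_sub0 AM; have M0 := ip_id0 AM.
have [||sA _] := AMmax (adjoin_ideal_pair AM Mz1); try by move=> a; apply: sub_adjoin.
exact: sA (adjoin_gen _ AM).
Qed.

(** Otherwise [1] would be a polynomial in [1 / (1 - m)] with coefficients in
    [M]; clearing denominators puts a power of [1 - m] in [M], although that power
    is congruent to [1] modulo [M]. *)
Lemma maximal_inv1B m : M m -> A (1 - m)^-1.
Proof.
move=> Mm; apply: contrapT => /maximal_adjoin1[p Mp p1].
have m1 : 1 - m != 0.
  by apply/eqP => /subr0_eq m1; apply: (ip_id1 AM); rewrite m1.
have A1m : A (1 - m) by exact: (ip_subB AM (ip_one AM) (ip_sub AM Mm)).
set n := size p.
have M1m : M ((1 - m) ^+ n).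
  rewrite -[X in M X]mulr1 [X in _ * X]p1 horner_coef mulr_sumr.
  apply: (ip_id_sum AM) => i _.
  rewrite mulrCA exprVn -exprB ?unitfE ?(ltnW (ltn_ord i)) // mulrC.
  exact: (ip_idM AM (ip_subX AM _ A1m) (Mp i)).
have Mpow k : M (1 - (1 - m) ^+ k).
  elim: k => [|k IH]; first by rewrite expr0 subrr; apply: (ip_id0 AM).
  have -> : 1 - (1 - m) ^+ k.+1 = 1 - (1 - m) ^+ k + (1 - m) ^+ k * m.
    by rewrite exprSr mulrBr mulr1 opprB addrA addrAC -addrA [X in _ + X]addrC.
  exact: (ip_idD AM IH (ip_idM AM (ip_subX AM _ A1m) Mm)).
by apply: (ip_id1 AM); rewrite -[1](subrK ((1 - m) ^+ n)); apply: (ip_idD AM).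
Qed.

(** The relation [1 = q(1/z)], multiplied by [z ^ deg q] and by the inverse of the
    unit [1 - q 0], expresses [z ^ deg q] through lower powers of [z]; this
    eliminates the leading term of [p]. *)
Lemma adjoin1_reduce z p q : z != 0 -> (size q <= size p)%N ->
  (forall i, M p`_i) -> (forall i, M q`_i) -> 1 = p.[z] -> 1 = q.[z^-1] ->
  exists p', [/\ (size p' < size p)%N, forall i, M p'`_i & 1 = p'.[z]].
Proof.
move=> z0 qp Mp Mq p1 q1.
have szq : (1 < size q)%N.
  rewrite ltnNge; apply/negP => /size1_polyC qC.
  by apply: (ip_id1 AM); rewrite q1 qC hornerC.
have szp : (1 < size p)%N := leq_trans szq qp.
set n := (size p).-1; set m := (size q).-1.
have nE : size p = n.+1 by rewrite prednK // ltnW.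
have mE : size q = m.+1 by rewrite prednK // ltnW.
have mn : (m <= n)%N by rewrite -ltnS -nE -mE.
pose s := (1 - q`_0)^-1; have As : A s := maximal_inv1B (Mq 0%N).
have s0 : 1 - q`_0 != 0.
  by apply/eqP => /subr0_eq q0; apply: (ip_id1 AM); rewrite q0.
have zm : z ^+ m = \sum_(i < m) (s * q`_i.+1) * z ^+ (m - i.+1).
  have : z ^+ m * (1 - q`_0) = \sum_(i < m) q`_i.+1 * z ^+ (m - i.+1).
    apply/eqP; rewrite mulrBr mulr1 subr_eq -{1}[z ^+ m]mulr1 {1}q1.
    rewrite horner_coef mE big_ord_recl /= expr0 mulr1 mulrDr addrC mulr_sumr.
    apply/eqP; congr (_ + _); apply: eq_bigr => i _.
    by rewrite mulrCA exprVn -exprB ?unitfE ?ltn_ord //.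
  move=> /(congr1 ( *%R s)); rewrite mulrCA [X in _ * X = _]mulVf // mulr1 => ->.
  by rewrite mulr_sumr; apply: eq_bigr => i _; rewrite mulrA.
pose r := \sum_(i < m) (p`_n * (s * q`_i.+1)) *: 'X^(n - i.+1).
pose p' := \poly_(i < n) p`_i + r.
exists p'; split.
- rewrite nE ltnS (leq_trans (size_polyD _ _)) // geq_max size_poly /=.
  rewrite (leq_trans (size_sum _ _ _)) //; apply/bigmax_leqP => i _.
  rewrite (leq_trans (size_scale_leq _ _)) // size_polyXn ltn_subrL /=.
  exact: leq_ltn_trans (leq0n i) (leq_trans (ltn_ord i) mn).
- move=> i; rewrite coefD coef_poly; apply: (ip_idD AM).
    by case: ifP => _; [apply: Mp | apply: (ip_id0 AM)].
  rewrite coef_sum; apply: (ip_id_sum AM) => j _; rewrite coefZ coefXn.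
  rewrite mulrC; apply: (ip_idM AM).
    by case: eqP => _; [apply: (ip_one AM) | apply: (ip_sub0 AM)].
  exact: (ip_idM AM (ip_sub AM (Mp n)) (ip_idM AM As (Mq _))).
- rewrite {1}p1 horner_coef nE big_ord_recr /= hornerD horner_poly.
  congr (_ + _); rewrite -(subnK mn) exprD zm !mulr_sumr horner_sum.
  rewrite subnK //; apply: eq_bigr => i _; rewrite hornerZ hornerXn.
  rewrite -!mulrA; congr (_ * _); rewrite mulrCA; congr (_ * _).
  rewrite mulrCA; congr (_ * _); rewrite -exprD.
  by congr (_ ^+ _); rewrite addnBA ?subnK.
Qed.

(** If neither [z] nor [1/z] were in [A], two relations as above would exist, and
    the longer of the two could be shortened for ever. *)
Lemma maximal_val_or_inv z : A z \/ A z^-1.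
Proof.
apply: contrapT => /not_orP[nAz nAz'].
have z0 : z != 0.
  by apply: contra_notN nAz => /eqP ->; apply: (ip_sub0 AM).
have [p Mp p1] := maximal_adjoin1 nAz; have [q Mq q1] := maximal_adjoin1 nAz'.
have [k] := ubnP (size p + size q)%N.
elim: k z z0 p q {nAz nAz'} Mp p1 Mq q1 => // k IH z z0 p q Mp p1 Mq q1.
rewrite ltnS; have [qp|/ltnW pq] := leqP (size q) (size p) => szk.
  have [p' [szp' Mp' p'1]] := adjoin1_reduce z0 qp Mp Mq p1 q1.
  by apply: (IH z z0 p' q) => //; apply: leq_trans szk; rewrite ltn_add2r.
have z'0 : z^-1 != 0 by rewrite invr_eq0.
have p1' : 1 = p.[z^-1^-1] by rewrite invrK.
have [q' [szq' Mq' q'1]] := adjoin1_reduce z'0 pq Mq Mp q1 p1'.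
by apply: (IH z z0 p q') => //; apply: leq_trans szk; rewrite ltn_add2l.
Qed.

(** By maximality [1] lies in the ideal generated by [M] and [a], so that a
    multiple of [a] has the form [1 - m]. *)
Lemma maximal_unit a : A a -> ~ M a -> A a^-1.
Proof.
move=> Aa nMa.
pose N : set L := [set x | exists m b, [/\ M m, A b & x = m + b * a]]%classic.
have [N1|nN1] := pselect (N 1); last first.
  case: nMa; have [|||_] := @AMmax A N; last 1 first.
  - apply; exists 0, 1; rewrite add0r mul1r.
    by split; [apply: (ip_id0 AM) | apply: (ip_one AM) |].
  - split=> //; try solve [exact: (ip_one AM) | exact: (ip_subB AM)
      | exact: (ip_subM AM)].
    + move=> _ [m [b [Mm Ab ->]]]; apply: (ip_subD AM); first by apply: (ip_sub AM).
      by apply: (ip_subM AM).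
    + move=> _ _ [m [b [Mm Ab ->]]] [m' [b' [Mm' Ab' ->]]].
      exists (m - m'), (b - b'); split; first exact: (ip_idB AM).
        exact: (ip_subB AM).
      by rewrite mulrBl opprD addrACA.
    + move=> c _ Ac [m [b [Mm Ab ->]]]; exists (c * m), (c * b); split.
      * exact: (ip_idM AM).
      * exact: (ip_subM AM).
      * by rewrite mulrDr mulrA.
    + exists 0, 0; rewrite mul0r addr0.
      by split; [apply: (ip_id0 AM) | apply: (ip_sub0 AM) |].
  - by [].
  - move=> m Mm; exists m, 0; rewrite mul0r addr0.
    by split => //; apply: (ip_sub0 AM).
have [m [b [Mm Ab /esym mba]]] := N1.
have a0 : a != 0 by apply: contra_notN nMa => /eqP ->; apply: (ip_id0 AM).
have baE : b * a = 1 - m by rewrite -mba addrC addKr.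
have m1 : 1 - m != 0.
  by apply/eqP => /subr0_eq m1; apply: (ip_id1 AM); rewrite m1.
have -> : a^-1 = b * (1 - m)^-1.
  by apply: (mulfI a0); rewrite divff // mulrCA mulrA baE divff.
by apply: (ip_subM AM) => //; apply: maximal_inv1B.
Qed.

Lemma maximal_valuation_pair : valuation_pair A M.
Proof.
split=> // z nAz; have [//|Az'] := maximal_val_or_inv z.
apply: contrapT => nMz; apply: nAz.
by rewrite -[z]invrK; apply: maximal_unit.
Qed.

End MaximalPair.

Lemma exists_valuation_pair A0 M0 : ideal_pair A0 M0 ->
  exists A M, [/\ valuation_pair A M, (A0 `<=` A)%classic & (M0 `<=` M)%classic].
Proof.
move=> /maximal_ideal_pair[A [M [AM sA sM AMmax]]].
by exists A, M; split => //; apply: maximal_valuation_pair.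
Qed.

End IdealPairs.

(** * Extending a valuation to an algebraic extension *)

Lemma seq_extremum (T : eqType) (s : seq T) (r : T -> T -> Prop) :
  {in s &, forall x y, r x y \/ r y x} ->
  {in s & &, forall x y z, r x y -> r y z -> r x z} ->
  s != [::] -> exists2 x, x \in s & forall y, y \in s -> r y x.
Proof.
elim: s => // x [|y s] IH tot trans _.
  exists x; rewrite ?mem_head // => y; rewrite inE => /eqP ->.
  by have [] := tot x x (mem_head _ _) (mem_head _ _).
have sub z : z \in y :: s -> z \in x :: y :: s by move=> zs; rewrite inE zs orbT.
have [||//|z zs zmax] := IH.
- by move=> u w us ws; apply: tot; apply: sub.
- by move=> u w t us ws ts; apply: trans; apply: sub.
have [xz|zx] := tot x z (mem_head _ _) (sub z zs).
  by exists z => [|w]; [exact: sub | rewrite inE => /predU1P[->|/zmax]].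
exists x => [|w]; rewrite ?mem_head // inE => /predU1P[->|ws].
  by have [] := tot x x (mem_head _ _) (mem_head _ _).
by apply: trans (zmax w ws) zx; rewrite ?mem_head ?sub.
Qed.

Section FiniteValues.
Variables (G : oagType).
Implicit Types (x y z : withinf G) (g h : G).

Lemma winf_ltD2l g x y : (Fin g + x < Fin g + y) = (x < y).
Proof.
by case: x y => [x|] [y|] //; rewrite !winf_ltE oag_ltD2lE.
Qed.

Lemma oag_mulrn_ge0 g n : 0 <= g -> 0 <= g *+ n.
Proof.
move=> g0; elim: n => [|n IH]; rewrite ?mulr0n // mulrS -[0]addr0.
exact: oag_leD.
Qed.

Lemma oag_mulrn_lt0 g n : (0 < n)%N -> g < 0 -> g *+ n < 0.
Proof.
case: n => // n _ g0; elim: n => [|n IH] //; rewrite mulrS -[0]addr0.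
exact: oag_ltD g0 (ltW IH).
Qed.

Lemma oag_mulrn_ge0E g n : (0 < n)%N -> (0 <= g *+ n) = (0 <= g).
Proof.
move=> n0; apply/idP/idP; last exact: oag_mulrn_ge0.
by rewrite !leNgt; apply: contra => /(oag_mulrn_lt0 n0).
Qed.

Variables (K : fieldType) (v : valuation K G).

Lemma vfun_fieldE (a : K) : a != 0 -> exists g, v a = Fin g.
Proof.
move=> a0; case va: (v a) => [g|]; first by exists g.
by have := vfun1 v; rewrite -(divff a0) vfunM va.
Qed.

Lemma vfunV (a : K) g : v a = Fin g -> v a^-1 = Fin (- g).
Proof.
move=> va; have a0 : a != 0 by apply/eqP => a0; rewrite a0 vfun0 in va.
have [h vh] : exists h, v a^-1 = Fin h by apply: vfun_fieldE; rewrite invr_eq0.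
have := vfun1 v; rewrite -(divff a0) vfunM va vh => -[gh].
by rewrite -[h](addKr g) gh addr0.
Qed.

End FiniteValues.

Lemma vfunX (R : comNzRingType) (G : oagType) (v : valuation R G) a g n :
  v a = Fin g -> v (a ^+ n) = Fin (g *+ n).
Proof.
move=> va; elim: n => [|n IH]; first by rewrite expr0 vfun1.
by rewrite exprS vfunM va IH mulrS.
Qed.

Section ValuationPairTheory.
Variables (L : fieldType) (A M : set L) (VI : valuation_pair A M).
Implicit Types a b z : L.
Let AM := vp_proper VI.

Lemma vp_unit a : A a -> ~ M a -> A a^-1.
Proof.
by move=> Aa nMa; apply: contrapT => /(vp_total VI); rewrite invrK.
Qed.

Lemma vp_invN a : a != 0 -> M a -> ~ A a^-1.
Proof.
by move=> a0 Ma Aa; apply: (ip_unit_notin AM Aa Ma); rewrite mulVf.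
Qed.

Lemma vp_root a n : (0 < n)%N -> A (a ^+ n) -> A a.
Proof.
move=> n0 Aan; apply: contrapT => nAa; have Ma := vp_total VI nAa.
have a0 : a != 0 by apply: contra_notN nAa => /eqP ->; apply: (ip_sub0 AM).
apply: (ip_unit_notin AM Aan (ip_idX AM Ma n0)).
by rewrite -exprMn divff // expr1n.
Qed.

(** Divisibility in a valuation ring is a total preorder. *)
Lemma vp_dominant (I : eqType) (r : seq I) (t : I -> L) :
  (forall i, i \in r -> t i != 0) -> r != [::] ->
  exists2 i, i \in r & forall j, j \in r -> A (t j / t i).
Proof.
move=> t0; apply: (@seq_extremum _ _ (fun j i => A (t j / t i))) => [i j|i j k] ir jr.
  have [|nA] := pselect (A (t i / t j)); [by left | right].
  by rewrite -invf_div; apply: (ip_sub AM); apply: (vp_total VI).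
move=> kr Aij Ajk; have -> : t i / t k = (t i / t j) * (t j / t k).
  by rewrite mulrA divfK ?t0.
exact: (ip_subM AM).
Qed.

(** Up to a unit of [A], some power of an algebraic element lies in the base
    field: in a vanishing sum [sum c_i a ^ i], two terms must have equal minimal
    value, since a single dominant term could not be cancelled. *)
Lemma vp_tie (K : fieldType) (iota : {rmorphism K -> L}) a :
  a != 0 -> algebraicOver iota a ->
  exists n c, [/\ (0 < n)%N, c != 0, A (a ^+ n / iota c) & A (iota c / a ^+ n)].
Proof.
move=> a0 [p p0 /rootP].
rewrite horner_coef size_map_poly; set N := size p => pa0.
pose t (i : 'I_N) := iota p`_i * a ^+ i.
have t0 (i : 'I_N) : p`_i != 0 -> t i != 0.
  by move=> pi0; rewrite mulf_neq0 ?fmorph_eq0 ?expf_neq0.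
have pair (i j : 'I_N) : (i < j)%N -> p`_i != 0 -> p`_j != 0 ->
    A (t j / t i) -> A (t i / t j) ->
    exists n c, [/\ (0 < n)%N, c != 0, A (a ^+ n / iota c) & A (iota c / a ^+ n)].
  move=> ij pi0 pj0 Aji Aij; exists (j - i)%N, (p`_i / p`_j).
  have E : a ^+ (j - i) / iota (p`_i / p`_j) = t j / t i.
    rewrite exprB ?(ltnW ij) ?unitfE // fmorph_div invf_div /t invfM.
    by rewrite mulrACA; congr (_ * _); exact: mulrC.
  split; first by rewrite subn_gt0.
  - by rewrite mulf_neq0 ?invr_eq0.
  - by rewrite E.
  - by rewrite -invf_div E invf_div.
pose r := [seq i : 'I_N <- enum 'I_N | p`_i != 0].
have memr (i : 'I_N) : (i \in r) = (p`_i != 0) by rewrite mem_filter mem_enum andbT.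
have Np : (0 < N)%N by rewrite size_poly_gt0.
have r0 : r != [::].
  have lt : (N.-1 < N)%N by rewrite prednK.
  have : Ordinal lt \in r by rewrite memr -lead_coefE lead_coef_eq0.
  by case: (r).
have [|i + iP] := @vp_dominant _ r t _ r0; first by move=> i; rewrite memr => /t0.
rewrite memr => pi0.
have [[j [ji pj0 nMj]]|nj] :=
    pselect (exists j : 'I_N, [/\ j != i, p`_j != 0 & ~ M (t j / t i)]).
  have Aji : A (t j / t i) by apply: iP; rewrite memr.
  have Aij : A (t i / t j) by rewrite -invf_div; apply: vp_unit.
  have [ij|ji'|/val_inj ij] := ltngtP i j.
  - exact: (pair i j).
  - exact: (pair j i).
  - by rewrite ij eqxx in ji.
case: (ip_id1 AM); rewrite -[1]opprK; apply: (ip_idN AM).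
have -> : -1 = \sum_(j < N | j != i) t j / t i.
  have : \sum_(j < N) t j / t i = 0.
    rewrite -mulr_suml (_ : \sum_j _ = 0) ?mul0r // -[RHS]pa0.
    by apply: eq_bigr => j _; rewrite coef_map.
  rewrite (bigD1 i) //= divff ?t0 // => /eqP.
  by rewrite addrC addr_eq0 => /eqP.
apply: (ip_id_sum AM) => j ji.
have [pj0|pj0] := eqVneq p`_j 0.
  by rewrite /t pj0 rmorph0 !mul0r; apply: (ip_id0 AM).
by apply: contrapT => nM; apply: nj; exists j.
Qed.

End ValuationPairTheory.

Section Extension.
Variables (K L : fieldType) (G : oagType) (iota : {rmorphism K -> L}).
Variables (nu0 : valuation K G).
Hypothesis G_div : divisible G.
Hypothesis L_alg : forall a : L, algebraicOver iota a.

(** A valuation pair above [nu0] defines a valuation with values in [G]: as some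
    power of each element agrees with an element of [K] up to a unit, its value
    is obtained from [nu0] by a division in [G]. *)
Section FromPair.
Variables (A M : set L) (VI : valuation_pair A M).
Hypothesis A_O : forall c, Fin 0 <= nu0 c -> A (iota c).
Hypothesis M_m : forall c, Fin 0 < nu0 c -> M (iota c).
Let AM := vp_proper VI.

Definition has_value (a : L) (g : G) : Prop :=
  a != 0 /\ exists n c, [/\ (0 < n)%N, nu0 c = Fin (g *+ n),
    A (a ^+ n / iota c) & A (iota c / a ^+ n)].

Lemma valuation_neq0 c g : nu0 c = Fin g -> c != 0.
Proof. by move=> vc; apply/eqP => c0; rewrite c0 vfun0 in vc. Qed.

Lemma has_value_ex a : a != 0 -> exists g, has_value a g.
Proof.
move=> a0; have [n [c [n0 c0 A1 A2]]] := vp_tie VI a0 (L_alg a).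
have [h vh] := vfun_fieldE nu0 c0; have [g gh] := G_div h n0.
by exists g; split => //; exists n, c; rewrite gh.
Qed.

Lemma has_valueM a b g h :
  has_value a g -> has_value b h -> has_value (a * b) (g + h).
Proof.
move=> [a0 [n [c [n0 vc A1 A2]]]] [b0 [m [d [m0 vd B1 B2]]]].
split; first exact: mulf_neq0.
exists (n * m)%N, (c ^+ m * d ^+ n); split.
- by rewrite muln_gt0 n0.
- by rewrite vfunM (vfunX _ vc) (vfunX _ vd) mulrnDl -!mulrnA [(m * n)%N]mulnC.
- have -> : (a * b) ^+ (n * m) / iota (c ^+ m * d ^+ n)
      = (a ^+ n / iota c) ^+ m * (b ^+ m / iota d) ^+ n.
    rewrite rmorphM !rmorphXn exprMn invfM mulrACA !expr_div_n.
    by rewrite -!exprM [(m * n)%N]mulnC.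
  by apply: (ip_subM AM); apply: (ip_subX AM).
- have -> : iota (c ^+ m * d ^+ n) / (a * b) ^+ (n * m)
      = (iota c / a ^+ n) ^+ m * (iota d / b ^+ m) ^+ n.
    rewrite rmorphM !rmorphXn exprMn invfM mulrACA !expr_div_n.
    by rewrite -!exprM [(m * n)%N]mulnC.
  by apply: (ip_subM AM); apply: (ip_subX AM).
Qed.

Lemma has_valueV a g : has_value a g -> has_value a^-1 (- g).
Proof.
move=> [a0 [n [c [n0 vc A1 A2]]]]; split; first by rewrite invr_eq0.
exists n, c^-1; split => //; first by rewrite (vfunV vc) mulNrn.
  by rewrite fmorphV invrK exprVn mulrC.
by rewrite fmorphV exprVn invrK mulrC.
Qed.

(** The choice of the power and of the element of [K] does not matter, because
    [A] cuts out exactly the valuation ring of [nu0] on [K]. *)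
Lemma has_value_ge0 a g : has_value a g -> A a <-> 0 <= g.
Proof.
move=> [a0 [n [c [n0 vc A1 A2]]]]; have c0 := valuation_neq0 vc.
have ic0 : iota c != 0 by rewrite fmorph_eq0.
have an0 : a ^+ n != 0 by rewrite expf_neq0.
rewrite -(oag_mulrn_ge0E _ n0) -winf_leE -vc; split=> [Aa|vc0].
  have Ac : A (iota c).
    by rewrite -(divfK an0 (iota c)); apply: (ip_subM AM A2); apply: (ip_subX AM).
  rewrite leNgt; apply/negP; rewrite vc winf_ltE => lt0.
  have Mc : M (iota c^-1).
    apply: M_m; rewrite (vfunV vc) winf_ltE.
    by rewrite -(oag_ltD2lE (g *+ n)) addr0 subrr.
  by rewrite fmorphV in Mc; apply: (ip_unit_notin AM Ac Mc); rewrite divff.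
apply: (vp_root VI n0); rewrite -(divfK ic0 (a ^+ n)).
by apply: (ip_subM AM A1); apply: A_O.
Qed.

Lemma has_value_le a b g h :
  has_value a g -> has_value b h -> A (b / a) <-> g <= h.
Proof.
move=> ag bh; rewrite (has_value_ge0 (has_valueM bh (has_valueV ag))).
suff -> : (g <= h) = (0 <= h - g) by [].
by rewrite -[RHS](oag_leD2lE g) addr0 addrC subrK.
Qed.

Lemma has_value_uniq a g h : has_value a g -> has_value a h -> g = h.
Proof.
move=> ag ah; have A1 : A (a / a).
  by rewrite divff ?ag.1 //; apply: (ip_one AM).
by apply/le_anti/andP; split; [apply/(has_value_le ag ah) | apply/(has_value_le ah ag)].
Qed.

Definition pair_val (a : L) : withinf G :=
  if pselect (exists g, has_value a g) is left ex then Fin (projT1 (cid ex))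
  else Infty.

Lemma pair_valP a g : has_value a g -> pair_val a = Fin g.
Proof.
move=> ag; rewrite /pair_val; case: pselect => [ex|[]]; last by exists g.
by congr Fin; apply: has_value_uniq ag; apply: projT2 (cid ex).
Qed.

Lemma pair_val0 : pair_val 0 = Infty.
Proof.
by rewrite /pair_val; case: pselect => // ex; have [g []] := ex; rewrite eqxx.
Qed.

Lemma pair_val1 : pair_val 1 = Fin 0.
Proof.
apply: pair_valP; split; first exact: oner_neq0.
exists 1%N, 1; rewrite vfun1 mulr1n rmorph1 expr1 divr1.
by split => //; apply: (ip_one AM).
Qed.

Lemma pair_valM a b : pair_val (a * b) = pair_val a + pair_val b.
Proof.
have [->|a0] := eqVneq a 0; first by rewrite mul0r pair_val0.
have [->|b0] := eqVneq b 0; first by rewrite mulr0 pair_val0; case: (pair_val a).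
have [g ag] := has_value_ex a0; have [h bh] := has_value_ex b0.
by rewrite (pair_valP ag) (pair_valP bh) (pair_valP (has_valueM ag bh)).
Qed.

Lemma pair_valD a b : Order.min (pair_val a) (pair_val b) <= pair_val (a + b).
Proof.
suff min_left c d : pair_val c <= pair_val d -> pair_val c <= pair_val (c + d).
  by case: (leP (pair_val a)) => [/min_left //|/ltW/min_left]; rewrite addrC.
move: c d => {}a {}b ab; have [->|ab0] := eqVneq (a + b) 0.
  by rewrite pair_val0 winf_lexx.
have [b0|b0] := eqVneq b 0; first by rewrite b0 addr0.
have [h bh] := has_value_ex b0.
have [a0|a0] := eqVneq a 0.
  by rewrite a0 pair_val0 (pair_valP bh) in ab.
have [g ag] := has_value_ex a0; have [k abk] := has_value_ex ab0.
move: ab; rewrite (pair_valP ag) (pair_valP bh) (pair_valP abk) !winf_leE.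
move=> /(has_value_le ag bh) Aba; apply/(has_value_le ag abk).
by rewrite mulrDl divff //; apply: (ip_subD AM) => //; apply: (ip_one AM).
Qed.

Definition pair_valuation : valuation L G :=
  Valuation pair_valM pair_valD pair_val1 pair_val0.

Lemma pair_valuation_extends : extends iota nu0 pair_valuation.
Proof.
move=> c /=; have [->|c0] := eqVneq c 0; first by rewrite rmorph0 pair_val0 vfun0.
have [g vc] := vfun_fieldE nu0 c0; rewrite vc; apply: pair_valP.
have ic0 : iota c != 0 by rewrite fmorph_eq0.
split=> //; exists 1%N, c; rewrite mulr1n expr1 divff //.
by split => //; apply: (ip_one AM).
Qed.

Lemma pair_valuation_gt0 a : M a -> Fin 0 < pair_valuation a.
Proof.
move=> Ma /=; have [->|a0] := eqVneq a 0; first by rewrite pair_val0 winf_ltoo.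
have [g ag] := has_value_ex a0; rewrite (pair_valP ag) winf_ltE ltNge.
apply/negP => g0; apply: (vp_invN VI a0 Ma).
by apply/(has_value_ge0 (has_valueV ag)); rewrite -(oag_leD2lE g) addr0 subrr.
Qed.

End FromPair.

(** The hypothesis says that [y] is not invertible in [O[y]], with [O] the
    valuation ring of [nu0].  Polynomials over [O] whose constant coefficient has
    positive value then take, at [y], values that form a proper ideal of [O[y]]:
    if one of them were [1], dividing by the unit [1 - p 0] would invert [y]. *)
Lemma exists_extension_gt0 (y : L) :
  (forall p : {poly K}, (forall i, Fin 0 <= nu0 p`_i) ->
     y * (map_poly iota p).[y] <> 1) ->
  exists2 eta : valuation L G, extends iota nu0 eta & Fin 0 < eta y.
Proof.
move=> y1.
pose O : set {poly K} := [set p | forall i, Fin 0 <= nu0 p`_i]%classic.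
pose ev (p : {poly K}) := (map_poly iota p).[y].
have evB p q : ev (p - q) = ev p - ev q by rewrite /ev rmorphB hornerD hornerN.
have evM p q : ev (p * q) = ev p * ev q by rewrite /ev rmorphM hornerM.
have evC c : ev c%:P = iota c by rewrite /ev map_polyC hornerC.
have OB p q : O p -> O q -> O (p - q).
  by move=> Op Oq i; rewrite coefB; apply: vfun_leD; rewrite ?vfunN.
have OM p q : O p -> O q -> O (p * q).
  move=> Op Oq i; rewrite coefM; elim/big_ind: _ => [|a b|j _].
  - by rewrite vfun0 winf_lexx.
  - exact: vfun_leD.
  - by rewrite vfunM -[0 : G]addr0; apply: winf_leD.
have OC c : Fin 0 <= nu0 c -> O c%:P.
  by move=> vc i; rewrite coefC; case: ifP => _ //; rewrite vfun0 winf_lexx.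
pose A0 : set L := [set a | exists2 p, O p & a = ev p]%classic.
pose M0 : set L := [set a | exists p, [/\ O p, Fin 0 < nu0 p`_0 & a = ev p]]%classic.
have AM0 : ideal_pair A0 M0.
  split.
  - by exists 1%:P; [apply: OC; rewrite vfun1 | rewrite evC rmorph1].
  - by move=> _ _ [p Op ->] [q Oq ->]; exists (p - q); [apply: OB|].
  - by move=> _ _ [p Op ->] [q Oq ->]; exists (p * q); [apply: OM|].
  - by move=> _ [p [Op _ ->]]; exists p.
  - move=> _ _ [p [Op p0 ->]] [q [Oq q0 ->]]; exists (p - q); split=> //.
      exact: OB.
    by rewrite coefB; apply: vfun_ltD; rewrite ?vfunN.
  - move=> _ _ [p Op ->] [q [Oq q0 ->]]; exists (p * q); split=> //.
      exact: OM.
    by rewrite coefM big_ord1 vfunM addrC -[0 : G]addr0; apply: winf_ltD.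
  - exists 0; rewrite coef0 vfun0 /ev rmorph0 horner0; split=> //.
    by move=> i; rewrite coef0 vfun0 winf_lexx.
  - move=> [p [Op p0 p1]].
    have u0 : 1 - p`_0 != 0.
      by apply: contraTneq p0 => /subr0_eq <-; rewrite vfun1 ltxx.
    have vu : nu0 (1 - p`_0)^-1 = Fin 0.
      have v1 : Fin 0 <= nu0 (1 - p`_0).
        by apply: vfun_leD; rewrite ?vfun1 // vfunN.
      have [g vg] := vfun_fieldE nu0 u0.
      rewrite (vfunV vg); congr Fin; apply/eqP; rewrite oppr_eq0; apply/eqP.
      apply/le_anti/andP; split; last by rewrite -winf_leE -vg.
      rewrite leNgt -winf_ltE -vg; apply/negP => vg0.
      have := vfun_ltD vg0 p0; rewrite subrK vfun1 ltxx //.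
    pose q : {poly K} := (1 - p`_0)^-1 *: \poly_(i < (size p).-1) p`_i.+1.
    apply: (y1 q) => [i|].
      rewrite coefZ vfunM vu coef_poly -{1}[0 : G]addr0; apply: winf_leD => //.
      by case: ifP => _; rewrite ?vfun0 ?winf_lexx.
    have pE : p = (p`_0)%:P + 'X * \poly_(i < (size p).-1) p`_i.+1.
      apply/polyP => i; rewrite coefD coefC coefXM coef_poly.
      case: i => [|i] /=; rewrite ?addr0 // add0r ltn_predRL.
      by case: ltnP => // /(nth_default 0).
    have qE : y * ev (\poly_(i < (size p).-1) p`_i.+1) = 1 - iota p`_0.
      apply/eqP; rewrite eq_sym subr_eq p1 {1}pE /ev rmorphD rmorphM /= map_polyX.
      by rewrite map_polyC hornerD hornerC hornerM hornerX addrC.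
    rewrite /q linearZ /= hornerZ mulrCA -/(ev _) qE.
    by rewrite -{1}(rmorph1 iota) -rmorphB -rmorphM mulVf // rmorph1.
have [A [M [VI sA sM]]] := exists_valuation_pair AM0.
have A_O c : Fin 0 <= nu0 c -> A (iota c).
  by move=> vc; apply: sA; exists c%:P; [apply: OC | rewrite evC].
have M_m c : Fin 0 < nu0 c -> M (iota c).
  move=> vc; apply: sM; exists c%:P; rewrite coefC evC; split=> //.
  exact/OC/ltW.
exists (pair_valuation VI A_O M_m); first exact: pair_valuation_extends.
apply: pair_valuation_gt0; apply: sM; exists 'X; split.
- move=> i; rewrite coefX; case: eqP => _; first by rewrite vfun1.
  by rewrite vfun0 winf_lexx.
- by rewrite coefX vfun0 winf_ltoo.
- by rewrite /ev map_polyX hornerX.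
Qed.

End Extension.

(** * Initial forms and homogeneous factorization *)

Section SameInitialForm.
Variables (R : comNzRingType) (G : oagType) (v : valuation R G).
Implicit Types a b c : R.

(** Having the same nonzero initial form; stated in the ring itself, where
    computations are lighter than in its graded ring. *)
Definition vsim a b : bool := v a < v (a - b).

Lemma vfunBC a b : v (a - b) = v (b - a).
Proof. by rewrite -opprB vfunN. Qed.

Lemma vsim_val a b : vsim a b -> v b = v a.
Proof.
move=> ab; apply/le_anti/andP; split; last first.
  have -> : b = a + (b - a) by rewrite addrC subrK.
  by apply: vfun_leD => //; rewrite vfunBC ltW.
rewrite leNgt; apply/negP => vab.
by have := vfun_ltD vab ab; rewrite addrC subrK ltxx.
Qed.

Lemma vsim_fin a b : vsim a b -> exists g, v a = Fin g.
Proof.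
rewrite /vsim; case: (v a) => [g|]; first by exists g.
by rewrite ltNge winf_lexx.
Qed.

Lemma vsim_refl a g : v a = Fin g -> vsim a a.
Proof. by rewrite /vsim subrr vfun0 => ->; apply: winf_ltoo. Qed.

Lemma vsim_sym a b : vsim a b -> vsim b a.
Proof. by move=> ab; rewrite /vsim (vsim_val ab) vfunBC. Qed.

Lemma vsim_trans a b c : vsim a b -> vsim b c -> vsim a c.
Proof.
move=> ab bc; rewrite /vsim; have -> : a - c = (a - b) + (b - c).
  by rewrite addrA subrK.
by apply: vfun_ltD => //; rewrite -(vsim_val ab).
Qed.

Lemma vsimMr a b c g : v c = Fin g -> vsim a b -> vsim (c * a) (c * b).
Proof. by move=> vc ab; rewrite /vsim -mulrBr !vfunM vc winf_ltD2l. Qed.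

Lemma vsim_cancel a b c g : v c = Fin g -> vsim (c * a) (c * b) -> vsim a b.
Proof. by move=> vc; rewrite /vsim -mulrBr !vfunM vc winf_ltD2l. Qed.

Lemma vsimP a b g : v a = Fin g -> v b = Fin g -> cls v g a = cls v g b -> vsim a b.
Proof. by move=> va vb ab; rewrite /vsim va; apply/eq_cls; rewrite ?va ?vb. Qed.

Lemma init_coefE a g : v a = Fin g -> init v a g = cls v g a.
Proof. by move=> va; rewrite /= /init_coef va eqxx. Qed.

Lemma init_coef_eq0 a g h : v a = Fin g -> h != g -> init v a h = 0.
Proof.
rewrite /= /init_coef => -> hg; case: eqP => // -[gh].
by rewrite gh eqxx in hg.
Qed.

Lemma cls_neq0 a g : v a = Fin g -> cls v g a <> 0.
Proof. by move=> va /cls_eq0; rewrite va ltxx => /(_ (lexx _)). Qed.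

Lemma init_vsim a b : vsim a b -> init v a = init v b.
Proof.
move=> ab; have [g va] := vsim_fin ab; have vb := vsim_val ab; rewrite va in vb.
apply: gr_ext => h; have [->|hg] := eqVneq h g.
  rewrite !init_coefE //; apply/eq_cls; rewrite ?va ?vb ?lexx //.
  by rewrite -va.
by rewrite !(init_coef_eq0 _ hg).
Qed.

Lemma vsim_init a b g : v a = Fin g -> init v a = init v b -> vsim a b.
Proof.
move=> va ab; have := congr1 (fun x : gr v => x g) ab.
rewrite init_coefE // /= /init_coef; case: eqP => [vb|_ /(cls_neq0 va)//].
exact: vsimP.
Qed.

Lemma init1 : init v 1 = 1.
Proof. by []. Qed.

Lemma init_gr_coef (x : gr v) g a : v a = Fin g -> x g = cls v g a ->
  (forall h, h != g -> x h = 0) -> x = init v a.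
Proof.
move=> va xg x0; apply: gr_ext => h; have [->|hg] := eqVneq h g.
  by rewrite init_coefE.
by rewrite x0 // (init_coef_eq0 va).
Qed.

Lemma init_mulE (x : gr v) a g h : v a = Fin g ->
  (init v a * x) h = piece_mul (cls v g a) (x (h - g)).
Proof.
move=> va; rewrite [LHS](@gr_mul_coefE _ _ _ _ _ [:: g]) //; last first.
  by move=> k; rewrite inE => kg; apply: init_coef_eq0 va kg.
by rewrite big_seq1 init_coefE.
Qed.

Lemma initM a b g h : v a = Fin g -> v b = Fin h ->
  init v (a * b) = init v a * init v b.
Proof.
move=> va vb; have vab : v (a * b) = Fin (g + h) by rewrite vfunM va vb.
symmetry; apply: (init_gr_coef vab) => [|k kgh]; rewrite (init_mulE _ _ va).
  have E : g + h - g = h by rewrite addrC addKr.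
  rewrite init_coefE ?E // piece_mulE ?va ?E ?vb //.
rewrite (init_coef_eq0 vb) ?piece_mul0r //.
by apply: contra kgh => /eqP <-; rewrite addrC subrK.
Qed.

Lemma initX a g n : v a = Fin g -> init v (a ^+ n) = init v a ^+ n.
Proof.
move=> va; elim: n => [|n IH]; first by rewrite !expr0 init1.
by rewrite !exprS (initM va (vfunX _ va)) IH.
Qed.

Lemma init_unit a b : vsim 1 (a * b) -> init v a \is a GRing.unit.
Proof.
move=> ab1; have := vsim_val ab1; rewrite vfunM vfun1.
case va: (v a) => [g|] //; case vb: (v b) => [h|] // _.
apply/unitrPr; exists (init v b).
by rewrite -(initM va vb) -(init_vsim ab1).
Qed.

(** Only the component of degree [- v a] of an inverse matters. *)
Lemma unit_init a g : v a = Fin g -> init v a \is a GRing.unit ->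
  exists b, vsim 1 (a * b).
Proof.
move=> va /unitrPr[x ax1].
have := congr1 (fun z : gr v => z 0) ax1.
rewrite (init_mulE _ _ va) -init1 (@init_coefE _ 0) ?vfun1 //.
set y := x _ => E; exists (rep y).
have va' : Fin g <= v a by rewrite va.
rewrite -[y]cls_rep piece_mulE ?repP // in E.
rewrite /vsim vfun1; apply/eq_cls; rewrite ?vfun1 ?lexx //.
exact: (PgeM va' (repP _)).
Qed.

Lemma vrep g (z : piece v g) : z != 0 -> v (rep z) = Fin g.
Proof.
move=> z0; apply/le_anti; rewrite repP andbT leNgt; apply/negP => lt.
by move/eqP: z0; apply; rewrite -[z]cls_rep; apply/cls_eq0 => //; apply: repP.
Qed.

(** Leading terms do not cancel: if [(d, e)] is the only pair of degrees
    contributing to degree [d + e], the product there is that of two nonzero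
    classes, and it is nonzero because [v] is multiplicative. *)
Lemma gr_mul_corner (x y : gr v) d e : x d != 0 -> y e != 0 ->
  (forall h, h != d -> x h != 0 -> y (d + e - h) = 0) -> (x * y) (d + e) != 0.
Proof.
move=> xd ye corner.
have [s [us xs]] := gr_supp_ex x.
have ds : d \in s by apply: contraNT xd => /xs ->.
rewrite [(x * y) _](gr_mul_coefE _ _ us xs) (bigD1_seq d) //= big1 => [|h hd].
  rewrite addr0; have dE : d + e - d = e by rewrite addrC addKr.
  apply/eqP/cls_neq0; rewrite vfunM !vrep ?dE //=; congr Fin.
have [->|xh] := eqVneq (x h) 0; first exact: piece_mul0l.
by rewrite (corner h) ?piece_mul0r.
Qed.

(** The order is a parameter so as to serve for highest and for lowest degrees. *)
Lemma gr_extremal_degree (x : gr v) (r : rel G) : total r -> transitive r ->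
  x != 0 -> exists2 d, x d != 0 & forall h, x h != 0 -> r h d.
Proof.
move=> tot trans x0; have [s [_ xs]] := gr_supp_ex x.
pose s' := [seq h <- s | x h != 0].
have mem_s' h : (h \in s') = (x h != 0).
  by rewrite mem_filter; case: eqP => //= /eqP xh; apply: contraNT xh => /xs ->.
have [||| d] := @seq_extremum _ s' r.
- by move=> h k _ _; apply/orP/tot.
- by move=> h k l _ _ _; apply: trans.
- apply: contra_neq x0 => s0; apply: gr_ext => h.
  by apply/eqP; have := mem_s' h; rewrite s0 in_nil => /esym/negbFE.
by rewrite mem_s' => xd dP; exists d => // h; rewrite -mem_s'; apply: dP.
Qed.

(** The highest degrees of the two factors add up to the degree of the product,
    and so do the lowest ones; hence they coincide in each factor. *)
Lemma init_mul_homogeneous (x y : gr v) a g : v a = Fin g -> x * y = init v a ->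
  exists b c k l,
    [/\ v b = Fin k, v c = Fin l, x = init v b & y = init v c].
Proof.
move=> va xya.
have init0 : init v a != 0.
  apply/eqP => /(congr1 (fun z : gr v => z g)).
  by rewrite init_coefE //; apply: cls_neq0.
have x0 : x != 0 by apply: contraNneq init0 => x0; rewrite -xya x0 mul0r.
have y0 : y != 0 by apply: contraNneq init0 => y0; rewrite -xya y0 mulr0.
have supp_a h : init v a h != 0 -> h = g.
  by move=> ah; apply/eqP; apply: contraNT ah => /(init_coef_eq0 va) ->.
have ge_total : total (>=%R : rel G) by move=> h k; apply: le_total.
have ge_trans : transitive (>=%R : rel G) by move=> h k l kh hl; apply: le_trans kh.
have [D xD Dmax] := gr_extremal_degree (@le_total _ G) le_trans x0.
have [E yE Emax] := gr_extremal_degree (@le_total _ G) le_trans y0.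
have [d xd dmin] := gr_extremal_degree ge_total ge_trans x0.
have [e ye emin] := gr_extremal_degree ge_total ge_trans y0.
have DE : D + E = g.
  apply: supp_a; rewrite -xya; apply: gr_mul_corner => // h hD xh.
  apply: contraTeq isT => /Emax; rewrite leNgt => /negP[].
  have hltD : h < D by rewrite lt_neqAle hD Dmax.
  by rewrite -(oag_ltD2lE h) addrC [h + _]addrC subrK [E + h]addrC oag_ltD.
have de : d + e = g.
  apply: supp_a; rewrite -xya; apply: gr_mul_corner => // h hd xh.
  apply: contraTeq isT => /emin; rewrite /= leNgt => /negP[].
  have dlth : d < h by rewrite lt_neqAle eq_sym hd; exact: dmin.
  by rewrite -(oag_ltD2lE h) [h + (_ - _)]addrC subrK oag_ltD.
have dD : d = D.
  apply/le_anti/andP; split; first exact: Dmax.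
  rewrite leNgt; apply/negP => dD; have := oag_ltD dD (Emax e ye).
  by rewrite DE de ltxx.
have eE : e = E by apply: (addrI D); rewrite DE -dD.
have homog (z : gr v) k : z k != 0 -> (forall h, z h != 0 -> h <= k) ->
    (forall h, z h != 0 -> k <= h) ->
    exists2 b, v b = Fin k & z = init v b.
  move=> zk kmax kmin; exists (rep (z k)); first exact: vrep.
  apply: (@init_gr_coef _ k); rewrite ?cls_rep //.
    exact: vrep.
  move=> h hk; apply/eqP; apply: contraNT hk => zh.
  by apply/eqP/le_anti/andP; split; [exact: kmax | exact: kmin].
rewrite dD in dmin; rewrite eE in emin.
have [b vb xb] := homog x D xD Dmax dmin.
have [c vc yc] := homog y E yE Emax emin.
by exists b, c, D, E.
Qed.

End SameInitialForm.

(** * Elements whose value increases *)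

Section Jump.
Variables (R : comNzRingType) (G : oagType) (nu mu : valuation R G).
Hypothesis nu_mu : forall a, nu a <= mu a.
Implicit Types a b : R.

Lemma jump_vsim a b : vsim nu a b -> nu a < mu a -> nu b < mu b.
Proof.
move=> ab aj; rewrite (vsim_val ab); have -> : b = a - (a - b) by rewrite subKr.
by apply: vfun_ltD; rewrite // vfunN; apply: lt_le_trans ab (nu_mu _).
Qed.

Lemma jumpMl a b h : nu a = Fin h -> nu b < mu b -> nu (a * b) < mu (a * b).
Proof.
move=> va; case vb: (nu b) => [g|] bj; last by rewrite ltNge winf_lexx in bj.
rewrite !vfunM va vb [Fin h + _]addrC [mu a + _]addrC; apply: (winf_ltD bj).
by rewrite -va.
Qed.

Lemma jump_mul a b : nu (a * b) < mu (a * b) -> nu a < mu a \/ nu b < mu b.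
Proof.
have [|ea] := ltP (nu a) (mu a); first by left.
have [|eb] := ltP (nu b) (mu b); first by right.
have -> : nu (a * b) = mu (a * b).
  by rewrite !vfunM; congr (_ + _); apply/le_anti; rewrite nu_mu.
by rewrite ltxx.
Qed.

End Jump.

Section MinimalJump.
Variables (K : fieldType) (G : oagType) (nu mu : valuation {poly K} G).
Hypothesis nu_mu : forall a, nu a <= mu a.
Hypothesis nu_fin : forall a : {poly K}, a != 0 -> exists g, nu a = Fin g.
Variable phi : {poly K}.
Hypothesis phi_jump : nu phi < mu phi.
Hypothesis phi_min : forall f : {poly K}, (size f < size phi)%N -> nu f = mu f.

Lemma phi_neq0 : phi != 0.
Proof. by apply: contraTneq phi_jump => ->; rewrite !vfun0 ltxx. Qed.

(** The remainder [s] does not jump, while [f] and [q * phi] do.  So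
    [nu s = mu s] exceeds the smaller of [nu f] and [nu (q * phi)], which forces
    these two to be equal, with the same initial form. *)
Lemma jump_divp f : nu f < mu f -> vsim nu f (f %/ phi * phi).
Proof.
move=> fj; have fE := divp_eq f phi.
set q := f %/ phi in fE *; set s := f %% phi in fE.
have sE : f - q * phi = s by rewrite [X in X - _]fE addrAC subrr add0r.
have vs : nu s = mu s by apply: phi_min; rewrite ltn_modp phi_neq0.
have q0 : q != 0.
  by apply: contraTneq fj => q0; rewrite fE q0 mul0r add0r vs ltxx.
have [g vq] := nu_fin q0; have qphij := jumpMl nu_mu vq phi_jump.
rewrite /vsim sE; have [fqphi|qphif] := leP (nu f) (nu (q * phi)).
  rewrite vs -sE; apply: vfun_ltD => //; rewrite vfunN.
  exact: le_lt_trans fqphi qphij.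
have : nu (q * phi) < nu (q * phi); last by rewrite ltxx.
rewrite -[X in _ < nu X](subKr f) sE; apply: vfun_ltD; rewrite // vfunN vs -sE.
apply: vfun_ltD; last by rewrite vfunN.
exact: lt_trans qphif fj.
Qed.

Hypothesis phi_size : (1 < size phi)%N.

Lemma jump_factor f : f != 0 -> exists r q,
  [/\ q != 0, nu q = mu q & vsim nu f (q * phi ^+ r)].
Proof.
have [n] := ubnP (size f); elim: n f => // n IH f szf f0.
have [fj|fnj] := ltP (nu f) (mu f); last first.
  have [g vf] := nu_fin f0; exists 0%N, f; rewrite expr0 mulr1.
  by split; [|apply/le_anti; rewrite nu_mu | apply: vsim_refl vf].
have fq := jump_divp fj; have [h vh] := nu_fin phi_neq0.
have q0 : f %/ phi != 0.
  apply/eqP => q0; have [g vf] := nu_fin f0.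
  by have := vsim_val fq; rewrite q0 mul0r vfun0 vf.
have [||r [q [q0' vq qs]]] := IH (f %/ phi) => //.
  have szphi : (0 < size phi)%N := ltnW phi_size.
  rewrite size_divp ?phi_neq0 // -ltnS (leq_trans _ szf) // ltnS ltn_subrL.
  by rewrite size_poly_gt0 f0 -ltnS prednK ?phi_size.
exists r.+1, q; split=> //; apply: vsim_trans fq _.
by rewrite exprS mulrCA [_ * phi]mulrC; apply: vsimMr vh qs.
Qed.

(** In a factorization, which may be taken homogeneous, one of the two factors
    jumps, hence is divisible by in(phi); cancelling [phi] shows that the other
    one is a unit. *)
Lemma init_phi_irreducible : irreducible_elt (init nu phi).
Proof.
have [h vphi] := nu_fin phi_neq0.
have jump_div1 b c k l : nu b = Fin k -> nu c = Fin l ->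
    vsim nu phi (b * c) -> nu b < mu b -> init nu c \is a GRing.unit.
  move=> vb vc phibc bj; have bq := jump_divp bj.
  apply: (@init_unit _ _ _ _ (b %/ phi)); apply: (vsim_cancel vphi).
  rewrite mulr1; apply: vsim_trans phibc _.
  rewrite mulrCA [phi * _]mulrC; rewrite [b * c]mulrC.
  exact: vsimMr vc bq.
split.
- apply/eqP => /(congr1 (fun z : gr nu => z h)).
  by rewrite init_coefE //; apply: cls_neq0.
- apply/negP => /(unit_init vphi)[b phib].
  have [k vb] : exists k, nu b = Fin k.
    have := vsim_val phib; rewrite vfunM vphi vfun1.
    by case: (nu b) => // k _; exists k.
  have := jumpMl nu_mu vb phi_jump; rewrite mulrC.
  by move=> /(jump_vsim nu_mu (vsim_sym phib)); rewrite !vfun1 ltxx.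
- move=> x y phixy.
  have [b [c [k [l [vb vc xb yc]]]]] := init_mul_homogeneous vphi (esym phixy).
  have phibc : vsim nu phi (b * c).
    by apply: (vsim_init vphi); rewrite (initM vb vc) phixy xb yc.
  have [bj|cj] := jump_mul nu_mu (jump_vsim nu_mu phibc phi_jump).
    by right; rewrite yc; apply: jump_div1 vb vc phibc bj.
  by left; rewrite xb; apply: jump_div1 vc vb _ cj; rewrite mulrC.
Qed.

End MinimalJump.

(** * Elements whose value does not increase *)

Lemma valuation_pair_of (L : fieldType) (G : oagType) (v : valuation L G) :
  valuation_pair [set a | Fin 0 <= v a]%classic [set a | Fin 0 < v a]%classic.
Proof.
split=> [|z /= /negP]; last first.
  rewrite -ltNge; have [->|z0] := eqVneq z 0.
    by rewrite vfun0 ltNge winf_lexx.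
  have [g vz] := vfun_fieldE v z0; rewrite vz (vfunV vz) !winf_ltE => g0.
  by rewrite -(oag_ltD2lE g) addr0 subrr.
split=> /=.
- by rewrite vfun1.
- by move=> a b va vb; apply: vfun_leD; rewrite ?vfunN.
- by move=> a b va vb; rewrite vfunM -[0 : G]addr0; apply: winf_leD.
- by move=> a /ltW.
- by move=> a b va vb; apply: vfun_ltD; rewrite ?vfunN.
- by move=> a b va vb; rewrite vfunM addrC -[0 : G]addr0; apply: winf_ltD.
- by rewrite vfun0 winf_ltoo.
- by rewrite vfun1 ltxx.
Qed.

Section SimpleExtension.
Variables (K : fieldType) (F : {poly K}) (hF : monic_irreducible_poly F).
Let L := {poly %/ F with hF}.
Let iota : {rmorphism K -> L} := qfpoly_pi hF \o polyC.

Lemma map_qfpoly_pi_horner (p q : {poly K}) :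
  (map_poly iota p).[qfpoly_pi hF q] = qfpoly_pi hF (p \Po q).
Proof. by rewrite map_poly_comp horner_map. Qed.

Lemma qfpoly_algebraic (a : L) : algebraicOver iota a.
Proof.
apply/integral_algebraic; rewrite -(qfpoly_pi_surj a) -[val a]comp_polyXr.
rewrite -map_qfpoly_pi_horner; apply: integral_horner.
  by apply/integral_poly => i; rewrite coef_map; apply: integral_id.
exists F; first exact: hF.2.
apply/rootP; rewrite map_qfpoly_pi_horner comp_polyXr.
by apply/eqP; rewrite qfpoly_pi_eq0.
Qed.

Variables (G : oagType) (G_div : divisible G) (nu0 : valuation K G).
Variables (mu : valuation L G) (mu_ext : extends (qfpoly_const hF) nu0 mu).
Hypothesis mu_only : forall eta : valuation L G,
  extends (qfpoly_const hF) nu0 eta -> eta = mu.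

(** No other extension is available to make [y] positive, so [y] is invertible
    already in the ring it generates over the valuation ring of [nu0]. *)
Lemma unique_extension_unit (y : L) : mu y = Fin 0 ->
  exists2 p : {poly K}, (forall i, Fin 0 <= nu0 p`_i) &
    y * (map_poly iota p).[y] = 1.
Proof.
move=> vy; apply: contrapT => np.
have [|eta eta_ext] := @exists_extension_gt0 _ _ _ iota nu0 G_div qfpoly_algebraic y.
  by move=> p Op py; apply: np; exists p.
rewrite (mu_only (eta := eta)) ?vy ?ltxx // => c.
by rewrite -qfpoly_piC; apply: eta_ext.
Qed.

Variables (nu : valuation {poly K} G) (nu_ext : extends polyC nu0 nu).

(** If [q] does not jump, then [Q = q ^ n / c] has value [0] both for [nu] and in
    L, for some [n] and [c].  There, [Q p(Q) = 1 + w F] for some [p] over the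
    valuation ring of [nu0] and some [w]; replacing [F] by [q * s], which has the
    same initial form, exhibits a multiple of [q] with initial form [1]. *)
Lemma nonjump_unit (q s : {poly K}) g :
  (forall a : {poly K}, a != 0 -> exists g, nu a = Fin g) ->
  nu q = Fin g -> mu (qfpoly_pi hF q) = Fin g -> vsim nu F (q * s) ->
  exists b, vsim nu 1 (q * b).
Proof.
move=> nu_fin vq muq Fqs; set a := qfpoly_pi hF q in muq.
have iotaE c : mu (iota c) = nu0 c by rewrite /= qfpoly_piC.
have a0 : a != 0 by apply/eqP => a0; rewrite a0 vfun0 in muq.
have [n' [c [n'0 c0 /= ge0 le0]]] :=
  vp_tie (valuation_pair_of mu) a0 (qfpoly_algebraic a).
case: n' => // n in n'0 ge0 le0 *.
have [h vc] := vfun_fieldE nu0 c0.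
have mua : mu (a ^+ n.+1 / iota c) = Fin (g *+ n.+1 - h).
  by rewrite vfunM (vfunX _ muq) -fmorphV iotaE (vfunV vc).
have hE : g *+ n.+1 - h = 0.
  have mua' : mu (iota c / a ^+ n.+1) = Fin (- (g *+ n.+1 - h)).
    by rewrite -invf_div (vfunV mua).
  rewrite -/(iota c) mua winf_leE in ge0; rewrite -/(iota c) mua' winf_leE in le0.
  apply/le_anti; rewrite ge0 andbT.
  by rewrite -(oag_leD2lE (- (g *+ n.+1 - h))) addr0 addNr.
rewrite hE in mua.
have [p Op py1] := unique_extension_unit mua.
pose Q := c^-1%:P * q ^+ n.+1.
have piQ : qfpoly_pi hF Q = a ^+ n.+1 / iota c.
  by rewrite /Q rmorphM rmorphXn mulrC -fmorphV.
have vQ : nu Q = Fin 0.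
  by rewrite /Q vfunM nu_ext (vfunV vc) (vfunX _ vq) -hE addrC.
rewrite -piQ map_qfpoly_pi_horner -rmorphM in py1.
have vP : Fin 0 <= nu (p \Po Q).
  rewrite comp_polyE; elim/big_ind: _ => [|u w|i _].
  - by rewrite vfun0 winf_lexx.
  - exact: vfun_leD.
  - rewrite -mul_polyC vfunM nu_ext (vfunX _ vQ) mul0rn -[X in Fin X <= _]addr0.
    exact: winf_leD.
have /dvdpP[w QPw] : F %| Q * (p \Po Q) - 1.
  by rewrite -(qfpoly_pi_eq0 hF) rmorphB py1 rmorph1 subrr.
exists (c^-1%:P * q ^+ n * (p \Po Q) - w * s).
have -> : q * (c^-1%:P * q ^+ n * (p \Po Q) - w * s) = 1 + w * (F - q * s).
  have -> : q * (c^-1%:P * q ^+ n * (p \Po Q) - w * s) = Q * (p \Po Q) - w * (q * s).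
    by rewrite mulrBr [q * (w * s)]mulrCA /Q exprS !mulrA [q * c^-1%:P]mulrC.
  by rewrite mulrBr -QPw addrA [1 + _]addrC subrK.
rewrite /vsim opprD addrA subrr add0r vfunN vfun1.
have [->|w0] := eqVneq w 0; first by rewrite mul0r vfun0 winf_ltoo.
have [k vw] := nu_fin w w0.
have vwF : Fin 0 <= nu (w * F).
  rewrite -QPw; apply: vfun_leD; last by rewrite vfunN vfun1.
  by rewrite vfunM vQ -[X in Fin X <= _]addr0; apply: winf_leD.
apply: le_lt_trans vwF _.
by rewrite !vfunM vw winf_ltD2l.
Qed.

End SimpleExtension.

Theorem corollary1p4 (K : fieldType) (G : oagType) (G_div : divisible G)
  (nu0 : valuation K G)
  (F : {poly K}) (hF : monic_irreducible_poly F)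
  (mu : valuation {poly %/ F with hF} G)
  (mu_ext : extends (qfpoly_const hF) nu0 mu)
  (mu_only : forall eta : valuation {poly %/ F with hF} G,
     extends (qfpoly_const hF) nu0 eta -> eta = mu) :
  forall nu : valuation {poly K} G,
    extends polyC nu0 nu -> nu < pullback (qfpoly_pi hF) mu ->
    exists (phi u : gr nu) (r : nat),
      [/\ irreducible_elt phi, u \is a GRing.unit, (0 < r)%N
        & init nu F = u * phi ^+ r].
Proof.
move=> nu nu_ext; rewrite lt_neqAle => /andP[nu_neq /val_leP nu_mu].
set mu' := pullback (qfpoly_pi hF) mu in nu_neq nu_mu.
have [mu'_ext mu'_supp] := pullback_VFinf mu_ext.
have F0 : F != 0 := monic_neq0 hF.2.
have mu'_oo a : mu' a = Infty -> F %| a.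
  by move=> va; rewrite -mu'_supp; apply/eqP.
have nu_oo a : nu a = Infty -> F %| a.
  by move=> va; apply: mu'_oo; have := nu_mu a; rewrite va; case: (mu' a).
(* Otherwise nu would have support (F), and uniqueness would give nu = mu. *)
have nuF : nu F != Infty.
  apply: contra nu_neq => /eqP vF; apply/eqP.
  have VF : VFinf nu0 F nu.
    split=> // a; apply/eqP/idP => [/nu_oo //|/dvdpP[b ->]].
    by rewrite vfunM vF; case: (nu b).
  have [eta eta_ext ->] := VFinf_pullback hF VF.
  by rewrite (mu_only eta).
(* The support of nu is a prime ideal inside (F) that does not contain F: a
   nonzero element of it would be divisible by F, with a quotient of smaller
   degree that is again in the support. *)
have nu_fin (a : {poly K}) : a != 0 -> exists g, nu a = Fin g.
  have [n] := ubnP (size a); elim: n a => // n IH a sza a0.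
  case va: (nu a) => [g|]; first by exists g.
  have /dvdpP[b ab] := nu_oo a va.
  have b0 : b != 0 by apply: contra_neq a0 => b0; rewrite ab b0 mul0r.
  have [|//|h vb] := IH b.
    rewrite -ltnS (leq_trans _ sza) // ltnS ab size_Mmonic ?hF.2 //.
    have := hF.1.1; case: (size F) => [|[|k]] // _.
    by rewrite addnS /= addnS ltnS leq_addr.
  by move: va nuF; rewrite ab vfunM vb; case: (nu F).
have Fj : nu F < mu' F.
  have -> : mu' F = Infty by apply/eqP; rewrite -[_ == _]/(F \in vsupp mu') mu'_supp.
  by case: (nu F) nuF => [g|/eqP//] _; apply: winf_ltoo.
(* phi: a polynomial of least degree whose value increases from nu to mu. *)
pose jsize n := `[< exists2 f : {poly K}, size f = n & nu f < mu' f >].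
have exj : exists n, jsize n by exists (size F); apply/asboolP; exists F.
have [m /asboolP[phi phim phij] mmin] := ex_minnP exj.
have phi_min (f : {poly K}) : (size f < size phi)%N -> nu f = mu' f.
  move=> szf; apply/le_anti; rewrite nu_mu leNgt; apply/negP => fj.
  move: szf; rewrite ltnNge phim => /negP[]; apply: mmin.
  by apply/asboolP; exists f.
have phi_size : (1 < size phi)%N.
  rewrite ltnNge; apply: contraTN phij => /size1_polyC ->.
  by rewrite -leNgt nu_ext mu'_ext.
have [r [q [q0 vq Fq]]] := jump_factor nu_mu nu_fin phij phi_min phi_size F0.
have [g vqg] := nu_fin q q0.
have [b qb1] := nonjump_unit G_div mu_ext mu_only nu_ext nu_fin vqg
  (etrans (esym vq) vqg) Fq.
have [h vphi] := nu_fin phi (phi_neq0 phij).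
exists (init nu phi), (init nu q), r; split.
- exact: (init_phi_irreducible nu_mu nu_fin phij phi_min).
- exact: init_unit qb1.
- have qj := jump_vsim nu_mu Fq Fj.
  by case: r Fq qj => // Fq; rewrite mulr1 vq ltxx.
- by rewrite (init_vsim Fq) (initM vqg (vfunX r vphi)) (initX _ vphi).
Qed.
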